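(* Let $n\in\mathbb{N}$ and $0\le\alpha<1$. Then $$R_{\mathcal{S}^*_{Ne,n}}(\mathcal{CS}^*_n(\alpha))=\left(\frac{2}{3(1+n-\alpha)+\sqrt{9(1+n-\alpha)^2+4(4-3\alpha)}}\right)^{1/n},$$ and this radius is sharp, i.e. it is the exact value of the radius.
   Context: $\mathbb{D}=\{|z|<1\}$, $\mathbb{D}_r=\{|z|<r\}$. For $n\in\mathbb{N}$, $\mathcal{A}_n$ is the class of analytic functions on $\mathbb{D}$ of the form $f(z)=z+\sum_{k\ge n+1}a_kz^k$; for such $f$ let $\mathcal{Q}_f(z)=zf'(z)/f(z)$. $\mathcal{P}_n$ is the class of analytic $p(z)=1+\sum_{k\ge n}p_kz^k$ on $\mathbb{D}$ with $\mathrm{Re}\,p(z)>0$. $\mathcal{S}^*_n(\alpha)=\{g\in\mathcal{A}_n:\mathrm{Re}\,\mathcal{Q}_g(z)>\alpha,\ z\in\mathbb{D}\}$. The close-to-starlike class of type $\alpha$ is $\mathcal{CS}^*_n(\alpha)=\{f\in\mathcal{A}_n:\ f/g\in\mathcal{P}_n \text{ for some } g\in\mathcal{S}^*_n(\alpha)\}$. Let $\varphi_{Ne}(z)=1+z-z^3/3$ (univalent on $\mathbb{D}$), $\Omega_{Ne}=\varphi_{Ne}(\mathbb{D})$, $\mathcal{S}^*_{Ne}$ the set of $f$ ($f(0)=0,f'(0)=1$) with $\mathcal{Q}_f\prec\varphi_{Ne}$ (i.e. $\mathcal{Q}_f=\varphi_{Ne}\circ w$, $w:\mathbb{D}\to\mathbb{D}$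 analytic, $w(0)=0$), $\mathcal{S}^*_{Ne,n}=\mathcal{S}^*_{Ne}\cap\mathcal{A}_n$. For $\mathcal{G}\subset\mathcal{A}_n$, $R_{\mathcal{S}^*_{Ne,n}}(\mathcal{G})$ is the largest $\rho\in(0,1]$ such that $\mathcal{Q}_f(\mathbb{D}_\rho)\subseteq\Omega_{Ne}$ for all $f\in\mathcal{G}$. *)

(* Defs.v *)
From Stdlib Require Import Reals Lra.
Open Scope R_scope.

Definition C : Type := (R * R)%type.
Definition Re (z : C) : R := fst z.
Definition Im (z : C) : R := snd z.
Definition RtoC (x : R) : C := (x, 0).
Definition C0 : C := (0, 0).
Definition C1 : C := (1, 0).
Definition Cadd (z w : C) : C := (Re z + Re w, Im z + Im w).
Definition Copp (z : C) : C := (- Re z, - Im z).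
Definition Csub (z w : C) : C := Cadd z (Copp w).
Definition Cmul (z w : C) : C :=
  (Re z * Re w - Im z * Im w, Re z * Im w + Im z * Re w).
Definition Cinv (z : C) : C :=
  (Re z / (Re z ^ 2 + Im z ^ 2), - Im z / (Re z ^ 2 + Im z ^ 2)).
Definition Cdiv (z w : C) : C := Cmul z (Cinv w).
Definition Cnorm (z : C) : R := sqrt (Re z ^ 2 + Im z ^ 2).
Fixpoint Cpow (z : C) (k : nat) : C :=
  match k with O => C1 | S k' => Cmul z (Cpow z k') end.

Definition Cseries_cv (a : nat -> C) (z s : C) : Prop :=
  Un_cv (fun N => sum_f_R0 (fun k => Re (Cmul (a k) (Cpow z k))) N) (Re s) /\
  Un_cv (fun N => sum_f_R0 (fun k => Im (Cmul (a k) (Cpow z k))) N) (Im s).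

Definition Cderiv (f : C -> C) (z d : C) : Prop :=
  forall eps, 0 < eps -> exists delta, 0 < delta /\
    forall h, h <> C0 -> Cnorm h < delta ->
      Cnorm (Csub (Cdiv (Csub (f (Cadd z h)) (f z)) h) d) < eps.

Definition inDisk (r : R) (z : C) : Prop := Cnorm z < r.

Definition A_n (n : nat) (f : C -> C) : Prop :=
  exists a : nat -> C,
    a 0%nat = C0 /\ a 1%nat = C1 /\
    (forall k, (2 <= k)%nat -> (k <= n)%nat -> a k = C0) /\
    (forall z, inDisk 1 z -> Cseries_cv a z (f z)).

Definition P_n (n : nat) (p : C -> C) : Prop :=
  (exists c : nat -> C,
    c 0%nat = C1 /\
    (forall k, (1 <= k)%nat -> (k < n)%nat -> c k = C0) /\
    (forall z, inDisk 1 z -> Cseries_cv c z (p z))) /\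
  (forall z, inDisk 1 z -> 0 < Re (p z)).

Definition Qf_is (f : C -> C) (z q : C) : Prop :=
  f z <> C0 /\ exists d, Cderiv f z d /\ q = Cdiv (Cmul z d) (f z).

Definition Sstar_n (n : nat) (alpha : R) (g : C -> C) : Prop :=
  A_n n g /\
  forall z, inDisk 1 z -> z <> C0 ->
    exists q, Qf_is g z q /\ alpha < Re q.

Definition CSstar_n (n : nat) (alpha : R) (f : C -> C) : Prop :=
  A_n n f /\
  exists g p, Sstar_n n alpha g /\ P_n n p /\
    forall z, inDisk 1 z -> f z = Cmul (g z) (p z).

Definition phiNe (u : C) : C :=
  Csub (Cadd C1 u) (Cdiv (Cpow u 3) (RtoC 3)).
Definition OmegaNe (w : C) : Prop := exists u, inDisk 1 u /\ w = phiNe u.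

(* Q_f(D_rho) is contained in Omega_Ne (Q_f(0) = 1 = phiNe 0 in Omega_Ne) *)
Definition Qf_maps_into_OmegaNe (rho : R) (f : C -> C) : Prop :=
  forall z, inDisk rho z -> z <> C0 -> exists q, Qf_is f z q /\ OmegaNe q.

Definition is_radius_SNe (G : (C -> C) -> Prop) (rho : R) : Prop :=
  0 < rho <= 1 /\
  (forall f, G f -> Qf_maps_into_OmegaNe rho f) /\
  (forall r, 0 < r <= 1 -> (forall f, G f -> Qf_maps_into_OmegaNe r f) -> r <= rho).

(* Main.v *)
(** Write x = |z|^n. For f = g p with g in S*_n(alpha) and p in P_n one has
    Q_f = Q_g + z p'/p. The Schwarz lemma of order n gives |Q_g - 1| <= 2(1 - alpha)x/(1 - x),
    the Schwarz-Pick lemma gives MacGregor's bound |z p'/p| <= 2n x/(1 - x^2), and Omega_Ne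
    contains the disc |w - 1| < 2/3; so Q_f(z) lies in Omega_Ne as soon as
    (4 - 3 alpha)x^2 + 3(1 + n - alpha)x < 1. All estimates are equalities at positive z for
    f(z) = z (1 + z^n) / (1 - z^n)^(1 + 2(1 - alpha)/n), and at the positive root of the quadratic
    Q_f takes the value 5/3 = phi_Ne(1), a boundary point of Omega_Ne. *)

Require Import Defs.
From Stdlib Require Import Reals Lra Lia ClassicalEpsilon Classical.
From Coquelicot Require Import Coquelicot.
Open Scope R_scope.

(** * Complex power series *)

(** Functions are given by power series at 0 and derivatives as limits, whereas the quotients to be
    estimated are undefined at 0 or at the point under study. The maximum principle is therefore
    proved for functions with punctures, from compactness and second-order expansions, and no
    singularity is ever removed. MacGregor's bound needs more than Schwarz-Pick: when psi has
    modulus t < 1 at the point, a larger psi' is allowed, and the trade-off between the two is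
    settled by an elementary inequality between powers of |z|. The constant 2/3 is the minimum of |u
    - u^3/3| on |u| = 1, attained at u = 1, which is why the extremal function is tested at positive
    z. For sharpness, (1 - w)^(-beta) is introduced through its binomial coefficients; its
    differential equation yields both the logarithmic derivative and the absence of zeros, so no
    branch of a logarithm is chosen. Since f, g and p must all be sums of power series, they are
    built with multiplication by 1/(1 - w), 1 + w and z only, each of which acts simply on
    coefficients. *)

Definition cser (u : nat -> C) (s : C) : Prop :=
  is_series (fun k => fst (u k)) (fst s) /\ is_series (fun k => snd (u k)) (snd s).

Lemma cser_cv (a : nat -> C) (z s : C) :
  Cseries_cv a z s <-> cser (fun k => (a k * z ^ k)%C) s.
Proof.
  unfold Cseries_cv, cser. rewrite !is_series_Reals. reflexivity.
Qed.

Lemma cser_ext (u v : nat -> C) (s : C) :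
  (forall k, u k = v k) -> cser u s -> cser v s.
Proof.
  intros H [H1 H2]; split; eapply is_series_ext; eauto;
  intros k; simpl; now rewrite H.
Qed.

Lemma cser_plus (u v : nat -> C) (s t : C) :
  cser u s -> cser v t -> cser (fun k => (u k + v k)%C) (s + t)%C.
Proof.
  intros [H1 H2] [H3 H4]; split; simpl.
  - exact (is_series_plus _ _ _ _ H1 H3).
  - exact (is_series_plus _ _ _ _ H2 H4).
Qed.

Lemma cser_scal (c : C) (u : nat -> C) (s : C) :
  cser u s -> cser (fun k => (c * u k)%C) (c * s)%C.
Proof.
  intros [H1 H2]; split; simpl.
  - exact (is_series_minus _ _ _ _ (is_series_scal (fst c) _ _ H1)
             (is_series_scal (snd c) _ _ H2)).
  - exact (is_series_plus _ _ _ _ (is_series_scal (fst c) _ _ H2)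
             (is_series_scal (snd c) _ _ H1)).
Qed.

Lemma cser_minus (u v : nat -> C) (s t : C) :
  cser u s -> cser v t -> cser (fun k => (u k - v k)%C) (s - t)%C.
Proof.
  intros H1 H2.
  replace (s - t)%C with (s + (-(1)) * t)%C by ring.
  eapply cser_ext; [| exact (cser_plus _ _ _ _ H1 (cser_scal (-(1))%C _ _ H2))].
  intros k; simpl; ring.
Qed.

Lemma cser_unique (u : nat -> C) (s t : C) : cser u s -> cser u t -> s = t.
Proof.
  intros [H1 H2] [H3 H4].
  apply is_series_unique in H1, H2, H3, H4.
  destruct s, t; simpl in *; congruence.
Qed.

Lemma cser_S (u : nat -> C) (s : C) :
  cser (fun k => u (S k)) s <-> cser u (u 0%nat + s)%C.
Proof.
  split; intros [H1 H2]; split; simpl in *.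
  - apply (is_series_decr_1 (fun k => fst (u k))).
    match goal with |- is_series _ ?l => replace l with (fst s); [exact H1|] end.
    unfold plus, opp; simpl; ring.
  - apply (is_series_decr_1 (fun k => snd (u k))).
    match goal with |- is_series _ ?l => replace l with (snd s); [exact H2|] end.
    unfold plus, opp; simpl; ring.
  - apply (is_series_incr_1 (fun k => fst (u k))).
    match goal with |- is_series _ ?l => replace l with (fst (u 0%nat) + fst s) end; [exact H1|].
    unfold plus; simpl; ring.
  - apply (is_series_incr_1 (fun k => snd (u k))).
    match goal with |- is_series _ ?l => replace l with (snd (u 0%nat) + snd s) end; [exact H2|].
    unfold plus; simpl; ring.
Qed.

Lemma fst_le_Cmod (z : C) : Rabs (fst z) <= Cmod z.
Proof. eapply Rle_trans; [apply Rmax_l | apply Rmax_Cmod]. Qed.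

Lemma snd_le_Cmod (z : C) : Rabs (snd z) <= Cmod z.
Proof. eapply Rle_trans; [apply Rmax_r | apply Rmax_Cmod]. Qed.

Lemma Cmod_le_abs (z : C) : Cmod z <= Rabs (fst z) + Rabs (snd z).
Proof.
  replace z with (RtoC (fst z) + Ci * RtoC (snd z))%C at 1.
  - eapply Rle_trans; [apply Cmod_triangle|].
    rewrite Cmod_mult, !Cmod_R, Cmod_Ci. lra.
  - destruct z; unfold Ci, Cplus, Cmult, RtoC; simpl; f_equal; ring.
Qed.

Lemma cser_ex (u : nat -> C) (v : nat -> R) :
  (forall k, Cmod (u k) <= v k) -> ex_series v -> exists s, cser u s.
Proof.
  intros H Hv.
  destruct (ex_series_le (fun k => fst (u k)) v) as [s1 H1]; auto.
  { intros k; eapply Rle_trans; [apply fst_le_Cmod | apply H]. }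
  destruct (ex_series_le (fun k => snd (u k)) v) as [s2 H2]; auto.
  { intros k; eapply Rle_trans; [apply snd_le_Cmod | apply H]. }
  exists (s1, s2); split; assumption.
Qed.

Lemma Series_abs_bound (x v : nat -> R) :
  (forall k, Rabs (x k) <= v k) -> ex_series v -> Rabs (Series x) <= Series v.
Proof.
  intros H Hv.
  assert (Ha : ex_series (fun k => Rabs (x k))).
  { apply (ex_series_le (fun k => Rabs (x k)) v); auto. intros k.
    unfold norm; simpl; unfold abs; simpl. rewrite Rabs_Rabsolu; auto. }
  eapply Rle_trans; [apply Series_Rabs; exact Ha|].
  apply Series_le; auto. intros k; split; [apply Rabs_pos | apply H].
Qed.

Lemma Series_nonneg (v : nat -> R) : (forall k, 0 <= v k) -> ex_series v -> 0 <= Series v.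
Proof.
  intros H Hv. eapply Rle_trans; [apply Rabs_pos | apply (Series_abs_bound v v); auto].
  intros k; rewrite Rabs_pos_eq; auto with real.
Qed.

(** The factor 2 comes from bounding the two coordinates separately; it is harmless because only
    orders of magnitude are drawn from this estimate. *)
Lemma cser_bound (u : nat -> C) (v : nat -> R) (s : C) :
  (forall k, Cmod (u k) <= v k) -> ex_series v -> cser u s ->
  Cmod s <= 2 * Series v.
Proof.
  intros H Hv [H1 H2].
  apply is_series_unique in H1, H2.
  eapply Rle_trans; [apply Cmod_le_abs|].
  rewrite <- H1, <- H2.
  assert (Rabs (Series (fun k => fst (u k))) <= Series v).
  { apply Series_abs_bound; auto. intros k; eapply Rle_trans; [apply fst_le_Cmod | apply H]. }
  assert (Rabs (Series (fun k => snd (u k))) <= Series v).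
  { apply Series_abs_bound; auto. intros k; eapply Rle_trans; [apply snd_le_Cmod | apply H]. }
  lra.
Qed.

(* The radius of convergence is at least 1. *)
Definition tame (a : nat -> C) : Prop :=
  forall rho, 0 < rho < 1 -> exists M, forall k, Cmod (a k) * rho ^ k <= M.

(** Abel's argument: convergence at the real point [rho] makes the terms tend to 0, hence
    bounded. *)
Lemma tame_of_cv (a : nat -> C) :
  (forall z, Cmod z < 1 -> exists s, Cseries_cv a z s) -> tame a.
Proof.
  intros H rho Hr.
  destruct (H (RtoC rho)) as [s Hs].
  { rewrite Cmod_R, Rabs_pos_eq; lra. }
  apply cser_cv in Hs; destruct Hs as [H1 H2].
  assert (B : forall x : nat -> R, ex_series x -> exists M, forall k, Rabs (x k) <= M).
  { intros x Hx. apply ex_series_lim_0 in Hx.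
    destruct (filterlim_bounded x) as [M HM].
    - exists 0. exact Hx.
    - exists M. intros k; apply HM. }
  destruct (B _ (ex_intro _ _ H1)) as [M1 HM1].
  destruct (B _ (ex_intro _ _ H2)) as [M2 HM2].
  exists (M1 + M2). intros k.
  replace (Cmod (a k) * rho ^ k) with (Cmod (a k * RtoC rho ^ k)%C).
  - eapply Rle_trans; [apply Cmod_le_abs|]. specialize (HM1 k); specialize (HM2 k). lra.
  - rewrite Cmod_mult, Cmod_pow, Cmod_R, Rabs_pos_eq; lra.
Qed.

(** With sigma = rho (1 + d), Bernoulli's inequality (1 + d)^k >= 1 + k d absorbs the factor k + 1
    at the cost of the constant 1 + 1/d. *)
Lemma linear_le_geom (rho sigma : R) : 0 < rho < sigma ->
  exists M, 0 < M /\ forall k, INR (S k) * rho ^ k <= M * sigma ^ k.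
Proof.
  intros H. set (d := (sigma - rho) / rho).
  assert (Hd : 0 < d) by (apply Rdiv_lt_0_compat; lra).
  exists (1 + / d). split.
  { assert (0 < / d) by (apply Rinv_0_lt_compat; auto). lra. }
  intros k. replace sigma with (rho * (1 + d)) by (unfold d; field; lra).
  rewrite Rpow_mult_distr.
  assert (Hp : 0 < rho ^ k) by (apply pow_lt; lra).
  assert (Hb := poly k d Hd).
  assert (Hd' : 0 < / d) by (apply Rinv_0_lt_compat; auto).
  assert (0 <= INR k) by apply pos_INR.
  rewrite S_INR.
  assert (INR k + 1 <= (1 + / d) * (1 + d) ^ k).
  { apply Rle_trans with ((1 + / d) * (1 + INR k * d)).
    - replace ((1 + / d) * (1 + INR k * d)) with (1 + INR k * d + / d + INR k) by (field; lra).
      assert (0 <= INR k * d) by (apply Rmult_le_pos; lra). lra.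
    - apply Rmult_le_compat_l; lra. }
  nra.
Qed.

Lemma tame_deg (a : nat -> C) : tame a -> tame (fun k => (RtoC (INR (S k)) * a k)%C).
Proof.
  intros Ha rho Hr. set (sigma := (1 + rho) / 2).
  assert (Hs : 0 < rho < sigma) by (unfold sigma; lra).
  destruct (linear_le_geom rho sigma Hs) as [M [M0 HM]].
  destruct (Ha sigma) as [K HK]. { unfold sigma; lra. }
  exists (M * K). intros k. rewrite Cmod_mult, Cmod_R, Rabs_pos_eq by apply pos_INR.
  specialize (HM k); specialize (HK k).
  assert (0 <= Cmod (a k)) by apply Cmod_ge_0.
  apply Rle_trans with (Cmod (a k) * (M * sigma ^ k)); nra.
Qed.

Lemma tame_shift (a : nat -> C) : tame a -> tame (fun k => a (S k)).
Proof.
  intros Ha rho Hr. destruct (Ha rho Hr) as [M HM].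
  exists (M / rho). intros k. specialize (HM (S k)). simpl in HM.
  apply Rmult_le_reg_r with rho; [lra|].
  replace (M / rho * rho) with M by (field; lra). lra.
Qed.

Lemma tame_ex_series (a : nat -> C) (rho : R) :
  tame a -> 0 < rho < 1 -> ex_series (fun k => Cmod (a k) * rho ^ k).
Proof.
  intros Ha Hr. set (sigma := (1 + rho) / 2).
  destruct (Ha sigma) as [M HM]. { unfold sigma; lra. }
  apply (ex_series_le (fun k => Cmod (a k) * rho ^ k) (fun k => M * (rho / sigma) ^ k)).
  - intros k. unfold norm; simpl; unfold abs; simpl.
    assert (0 < sigma ^ k) by (apply pow_lt; unfold sigma; lra).
    assert (0 < rho ^ k) by (apply pow_lt; lra).
    rewrite Rabs_pos_eq by (apply Rmult_le_pos; [apply Cmod_ge_0 | lra]).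
    unfold Rdiv. rewrite Rpow_mult_distr, pow_inv.
    specialize (HM k).
    replace (Cmod (a k) * rho ^ k) with (Cmod (a k) * sigma ^ k * (rho ^ k * / sigma ^ k))
      by (field; lra).
    apply Rmult_le_compat_r; auto. apply Rmult_le_pos; [lra|].
    apply Rlt_le, Rinv_0_lt_compat; auto.
  - apply (ex_series_scal_l M (fun k => (rho / sigma) ^ k)). apply ex_series_geom.
    rewrite Rabs_pos_eq.
    + apply Rlt_div_l; unfold sigma; lra.
    + apply Rlt_le, Rdiv_lt_0_compat; unfold sigma; lra.
Qed.

Lemma tame_cv (a : nat -> C) (z : C) : tame a -> Cmod z < 1 -> exists s, Cseries_cv a z s.
Proof.
  intros Ha Hz. set (rho := (1 + Cmod z) / 2).
  assert (0 <= Cmod z) by apply Cmod_ge_0.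
  destruct (cser_ex (fun k => (a k * z ^ k)%C) (fun k => Cmod (a k) * rho ^ k)) as [s Hs].
  - intros k. rewrite Cmod_mult, Cmod_pow. apply Rmult_le_compat_l; [apply Cmod_ge_0|].
    apply pow_incr; unfold rho; lra.
  - apply tame_ex_series; auto. unfold rho; lra.
  - exists s. now apply cser_cv.
Qed.

(** Turns coefficients into a function. [Series] is total, so values outside the disc are
    conventional; only those inside are constrained. *)
Lemma tame_function (a : nat -> C) : tame a ->
  exists f : C -> C, forall w, Cmod w < 1 -> Cseries_cv a w (f w).
Proof.
  intros Hd.
  exists (fun w => (Series (fun k => fst (a k * w ^ k)%C), Series (fun k => snd (a k * w ^ k)%C))).
  intros w Hw. destruct (tame_cv a w Hd Hw) as [s Hs].
  apply cser_cv. apply cser_cv in Hs. destruct Hs as [H1 H2]. split; simpl;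
  apply Series_correct; eexists; eauto.
Qed.

(** * Termwise Taylor expansion of power series *)

(** These are k z^(k-1), binom(k,2) z^(k-2) and the remainder in the expansion of (z + h)^k to
    second order. The recursions result from multiplying that expansion by z + h, and they avoid
    truncated exponents. *)
Fixpoint dz1 (z : C) (k : nat) : C :=
  match k with O => 0%C | S j => (z * dz1 z j + z ^ j)%C end.
Fixpoint dz2 (z : C) (k : nat) : C :=
  match k with O => 0%C | S j => (z * dz2 z j + dz1 z j)%C end.
Fixpoint dz3 (z h : C) (k : nat) : C :=
  match k with O => 0%C | S j => ((z + h) * dz3 z h j + h ^ 3 * dz2 z j)%C end.

Lemma taylor_pow (z h : C) (k : nat) :
  ((z + h) ^ k = z ^ k + dz1 z k * h + dz2 z k * h ^ 2 + dz3 z h k)%C.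
Proof.
  induction k as [|k IH]; [simpl; ring|].
  rewrite !Cpow_S, IH. simpl. ring.
Qed.

Lemma dz1_S (z : C) (k : nat) : dz1 z (S k) = (RtoC (INR (S k)) * z ^ k)%C.
Proof.
  induction k as [|k IH]; [simpl; ring|].
  change (dz1 z (S (S k))) with (z * dz1 z (S k) + z ^ S k)%C.
  rewrite IH, (S_INR (S k)), RtoC_plus, Cpow_S. ring.
Qed.

(** The crude factors k^2 and k^3 in place of binomials make the induction close, through (k + 1)^2
    >= k^2 + k and (k + 1)^3 >= k^3 + k^2. Dividing by powers of [rho] stands for the exponents k -
    1, k - 2, k - 3. *)
Lemma dz_bounds (z h : C) (rho : R) (k : nat) :
  0 < rho -> Cmod z <= rho -> Cmod (z + h) <= rho ->
  Cmod (dz1 z k) <= INR k * rho ^ k / rho /\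
  Cmod (dz2 z k) <= INR k ^ 2 * rho ^ k / rho ^ 2 /\
  Cmod (dz3 z h k) <= INR k ^ 3 * rho ^ k / rho ^ 3 * Cmod h ^ 3.
Proof.
  intros Hr Hz Hzh.
  assert (Hrn : rho <> 0) by lra.
  induction k as [|k [I1 [I2 I3]]].
  { cbn [dz1 dz2 dz3 INR]; rewrite Cmod_0. unfold Rdiv. repeat split; apply Req_le; ring. }
  assert (P0 : 0 <= INR k) by apply pos_INR.
  assert (P1 := Cmod_ge_0 z). assert (P2 := Cmod_ge_0 (z + h)). assert (P3 := Cmod_ge_0 h).
  assert (Hp : 0 < rho ^ k) by (apply pow_lt; lra).
  assert (Hi : 0 < / rho) by (apply Rinv_0_lt_compat; lra).
  rewrite S_INR. cbn [dz1 dz2 dz3].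
  split; [|split].
  - eapply Rle_trans; [apply Cmod_triangle|]. rewrite Cmod_mult, Cmod_pow.
    assert (Cmod z * Cmod (dz1 z k) <= rho * (INR k * rho ^ k / rho))
      by (apply Rmult_le_compat; auto using Cmod_ge_0).
    assert (Cmod z ^ k <= rho ^ k) by (apply pow_incr; lra).
    replace ((INR k + 1) * rho ^ S k / rho) with (rho * (INR k * rho ^ k / rho) + rho ^ k)
      by (simpl; field; lra). lra.
  - eapply Rle_trans; [apply Cmod_triangle|]. rewrite Cmod_mult.
    assert (Cmod z * Cmod (dz2 z k) <= rho * (INR k ^ 2 * rho ^ k / rho ^ 2))
      by (apply Rmult_le_compat; auto using Cmod_ge_0).
    replace ((INR k + 1) ^ 2 * rho ^ S k / rho ^ 2)
      with (rho * (INR k ^ 2 * rho ^ k / rho ^ 2) + INR k * rho ^ k / rho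
            + (INR k + 1) * (rho ^ k * / rho)) by (simpl; field; lra).
    assert (0 <= (INR k + 1) * (rho ^ k * / rho)) by (apply Rmult_le_pos; nra). lra.
  - eapply Rle_trans; [apply Cmod_triangle|]. rewrite !Cmod_mult, Cmod_pow.
    assert (Cmod (z + h) * Cmod (dz3 z h k) <= rho * (INR k ^ 3 * rho ^ k / rho ^ 3 * Cmod h ^ 3))
      by (apply Rmult_le_compat; auto using Cmod_ge_0).
    assert (0 <= Cmod h ^ 3) by (apply pow_le; auto).
    assert (Cmod h ^ 3 * Cmod (dz2 z k) <= Cmod h ^ 3 * (INR k ^ 2 * rho ^ k / rho ^ 2))
      by (apply Rmult_le_compat_l; auto).
    replace ((INR k + 1) ^ 3 * rho ^ S k / rho ^ 3 * Cmod h ^ 3)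
      with (rho * (INR k ^ 3 * rho ^ k / rho ^ 3 * Cmod h ^ 3)
            + Cmod h ^ 3 * (INR k ^ 2 * rho ^ k / rho ^ 2)
            + (2 * INR k ^ 2 + 3 * INR k + 1) * ((rho ^ k * / rho ^ 2) * Cmod h ^ 3))
      by (simpl; field; lra).
    assert (0 < / rho ^ 2) by (apply Rinv_0_lt_compat, pow_lt; lra).
    assert (0 <= (2 * INR k ^ 2 + 3 * INR k + 1) * ((rho ^ k * / rho ^ 2) * Cmod h ^ 3)).
    { apply Rmult_le_pos; [nra|]. apply Rmult_le_pos; auto. apply Rmult_le_pos; lra. }
    lra.
Qed.

(* Having such an expansion at every point replaces holomorphy: it is preserved by
   quotients and suffices for the maximum principle, so no Cauchy theory is needed. *)
Definition jet (F : C -> C) (z b c : C) : Prop :=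
  exists K delta, 0 <= K /\ 0 < delta /\ forall h, Cmod h < delta ->
    Cmod (F (z + h) - (F z + b * h + c * h ^ 2))%C <= K * Cmod h ^ 3.

Definition dcoef (a : nat -> C) (k : nat) : C := (RtoC (INR (S k)) * a (S k))%C.

Lemma tame_dcoef (a : nat -> C) : tame a -> tame (dcoef a).
Proof.
  intros Ha rho Hr. destruct (tame_shift _ (tame_deg _ Ha) rho Hr) as [M HM].
  exists M. intros k. eapply Rle_trans; [|apply (HM k)]. unfold dcoef.
  assert (Hp : 0 < rho ^ k) by (apply pow_lt; lra).
  apply Rmult_le_compat_r; [lra|]. rewrite !Cmod_mult, !Cmod_R, !Rabs_pos_eq by apply pos_INR.
  apply Rmult_le_compat_r; [apply Cmod_ge_0|]. apply le_INR; lia.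
Qed.

(** The expansions of the monomials are summed, with [rho] halfway between |z| and 1. The single
    majorant (k + 1)^3 |a_k| rho^k dominates, up to powers of [rho], both the second coefficient and
    the remainder divided by |h|^3. *)
Lemma power_series_jet (a : nat -> C) (f f1 : C -> C) (z : C) :
  tame a -> (forall w, Cmod w < 1 -> Cseries_cv a w (f w)) ->
  (forall w, Cmod w < 1 -> Cseries_cv (dcoef a) w (f1 w)) ->
  Cmod z < 1 -> exists c, jet f z (f1 z) c.
Proof.
  intros Ha Hf Hf1 Hz. set (rho := (1 + Cmod z) / 2).
  assert (Hz0 := Cmod_ge_0 z).
  assert (Hr : 0 < rho < 1) by (unfold rho; lra).
  assert (Hzr : Cmod z <= rho) by (unfold rho; lra).
  set (v := fun k => INR (S k) ^ 3 * (Cmod (a k) * rho ^ k)).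
  assert (Hv : ex_series v).
  { assert (Q : forall k, Cmod (RtoC (INR (S k)) * (RtoC (INR (S k)) * (RtoC (INR (S k)) * a k)))%C
                          * rho ^ k = v k).
    { intros k. unfold v. rewrite !Cmod_mult, !Cmod_R, !Rabs_pos_eq by apply pos_INR. ring. }
    eapply ex_series_ext; [exact Q|].
    apply (tame_ex_series _ rho (tame_deg _ (tame_deg _ (tame_deg _ Ha))) Hr). }
  assert (Hi : 0 < / rho) by (apply Rinv_0_lt_compat; lra).
  assert (Hle : forall k : nat, INR k <= INR (S k)) by (intros; apply le_INR; lia).
  assert (Hd1 : cser (fun k => (a k * dz1 z k)%C) (f1 z)).
  { replace (f1 z) with (a 0%nat * dz1 z 0 + f1 z)%C by (simpl; ring).
    apply (cser_S (fun k => (a k * dz1 z k)%C)).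
    eapply cser_ext; [|apply cser_cv, (Hf1 z Hz)].
    intros k. unfold dcoef. rewrite dz1_S. ring. }
  destruct (cser_ex (fun k => (a k * dz2 z k)%C) (fun k => / rho ^ 2 * v k)) as [c Hc].
  { intros k. rewrite Cmod_mult.
    destruct (dz_bounds z 0 rho k) as [_ [B _]]; [lra|lra|rewrite Cplus_0_r; lra|].
    unfold v.
    assert (Q : INR k ^ 2 <= INR (S k) ^ 3).
    { apply Rle_trans with (INR (S k) ^ 2).
      - apply pow_incr; split; [apply pos_INR | apply Hle].
      - apply Rle_pow; [|lia]. rewrite S_INR. assert (0 <= INR k) by apply pos_INR. lra. }
    apply Rle_trans with (Cmod (a k) * (INR (S k) ^ 3 * rho ^ k / rho ^ 2)).
    - apply Rmult_le_compat_l; [apply Cmod_ge_0|].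
      eapply Rle_trans; [apply B|]. unfold Rdiv. rewrite !Rmult_assoc. apply Rmult_le_compat_r; auto.
      apply Rlt_le, Rmult_lt_0_compat; [apply pow_lt|apply Rinv_0_lt_compat, pow_lt]; lra.
    - right. field. lra. }
  { apply (ex_series_scal_l (/ rho ^ 2) v). exact Hv. }
  exists c, (2 * (/ rho ^ 3 * Series v)), (rho - Cmod z).
  assert (Hv0 : 0 <= Series v).
  { apply Series_nonneg; auto. intros k. unfold v.
    apply Rmult_le_pos; [apply pow_le, pos_INR|].
    apply Rmult_le_pos; [apply Cmod_ge_0 | apply pow_le; lra]. }
  assert (Hi3 : 0 < / rho ^ 3) by (apply Rinv_0_lt_compat, pow_lt; lra).
  split; [|split; [unfold rho; lra|]].
  { apply Rmult_le_pos; [lra|]. apply Rmult_le_pos; lra. }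
  intros h Hh.
  assert (Hzh : Cmod (z + h) <= rho).
  { eapply Rle_trans; [apply Cmod_triangle|]. lra. }
  assert (Hzh1 : Cmod (z + h) < 1) by lra.
  assert (E : cser (fun k => (a k * dz3 z h k)%C) (f (z + h) - (f z + f1 z * h + c * h ^ 2))%C).
  { apply cser_ext with (fun k => (a k * (z + h) ^ k - ((a k * z ^ k + h * (a k * dz1 z k)) + h ^ 2 * (a k * dz2 z k)))%C).
    - intros k. rewrite taylor_pow. ring.
    - apply cser_minus; [apply cser_cv, Hf; auto|].
      replace (f z + f1 z * h + c * h ^ 2)%C with (f z + h * f1 z + h ^ 2 * c)%C by ring.
      apply cser_plus; [apply cser_plus|]; try apply cser_scal; auto. apply cser_cv, Hf; auto. }
  assert (Hh0 : 0 <= Cmod h ^ 3) by apply pow_le, Cmod_ge_0.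
  assert (B : Cmod (f (z + h) - (f z + f1 z * h + c * h ^ 2))%C
              <= 2 * Series (fun k => / rho ^ 3 * Cmod h ^ 3 * v k)).
  { apply (cser_bound _ _ _) with (3 := E).
    - intros k. rewrite Cmod_mult.
      destruct (dz_bounds z h rho k ltac:(lra) Hzr Hzh) as [_ [_ B3]].
      apply Rle_trans with (Cmod (a k) * (INR (S k) ^ 3 * rho ^ k / rho ^ 3 * Cmod h ^ 3)).
      + apply Rmult_le_compat_l; [apply Cmod_ge_0|].
        eapply Rle_trans; [apply B3|].
        apply Rmult_le_compat_r; [exact Hh0|]. unfold Rdiv. rewrite !Rmult_assoc.
        apply Rmult_le_compat_r.
        * apply Rlt_le, Rmult_lt_0_compat; [apply pow_lt; lra | exact Hi3].
        * apply pow_incr; split; [apply pos_INR | apply Hle].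
      + right; unfold v; field; lra.
    - exact (ex_series_scal_l (/ rho ^ 3 * Cmod h ^ 3) v Hv). }
  rewrite Series_scal_l in B. eapply Rle_trans; [apply B|]. right. ring.
Qed.

(** Expansions of [f1] are recorded as well because z g'/g must itself be differentiable for the
    Schwarz lemma to apply to it. *)
Lemma power_series_deriv (a : nat -> C) (f : C -> C) :
  (forall w, Cmod w < 1 -> Cseries_cv a w (f w)) ->
  exists f1 : C -> C, (forall w, Cmod w < 1 -> Cseries_cv (dcoef a) w (f1 w)) /\
    (forall z, Cmod z < 1 -> exists c, jet f z (f1 z) c) /\
    (forall z, Cmod z < 1 -> exists b c, jet f1 z b c).
Proof.
  intros Hf.
  assert (Ha : tame a) by (apply tame_of_cv; eauto).
  destruct (tame_function _ (tame_dcoef _ Ha)) as [f1 Hf1].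
  destruct (tame_function _ (tame_dcoef _ (tame_dcoef _ Ha))) as [f2 Hf2].
  exists f1. split; [exact Hf1|]. split; intros z Hz.
  - eapply power_series_jet; eauto.
  - exists (f2 z). eapply power_series_jet; [apply tame_dcoef; exact Ha| | |]; eauto.
Qed.

(** Takes the place of factoring z^m out of the series: for k >= m and |z| <= 1/2, |z|^k <= |z|^m
    (1/2)^(k-m). It supplies the growth condition at 0 of the Schwarz lemma. *)
Lemma power_series_order (a : nat -> C) (f : C -> C) (m : nat) :
  (forall w, Cmod w < 1 -> Cseries_cv a w (f w)) ->
  (forall k, (k < m)%nat -> a k = 0%C) ->
  exists K, 0 <= K /\ forall z, Cmod z <= 1 / 2 -> Cmod (f z) <= K * Cmod z ^ m.
Proof.
  intros Hf Hm.
  assert (Ha : tame a) by (apply tame_of_cv; eauto).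
  set (v := fun k => Cmod (a k) * (1 / 2) ^ k).
  assert (Hv : ex_series v) by (apply tame_ex_series; auto; lra).
  assert (Hv0 : 0 <= Series v).
  { apply Series_nonneg; auto. intros k. unfold v.
    apply Rmult_le_pos; [apply Cmod_ge_0 | apply pow_le; lra]. }
  exists (2 * (2 ^ m * Series v)). split.
  { apply Rmult_le_pos; [lra|]. apply Rmult_le_pos; auto. apply pow_le; lra. }
  intros z Hz. assert (Hz0 := Cmod_ge_0 z).
  assert (B : Cmod (f z) <= 2 * Series (fun k => 2 ^ m * Cmod z ^ m * v k)).
  { apply (cser_bound (fun k => (a k * z ^ k)%C)).
    - intros k. destruct (Nat.lt_ge_cases k m) as [Hk|Hk].
      + rewrite (Hm k Hk), Cmult_0_l, Cmod_0. unfold v. rewrite (Hm k Hk), Cmod_0. lra.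
      + rewrite Cmod_mult, Cmod_pow. unfold v.
        replace k with (m + (k - m))%nat at 2 4 by lia.
        rewrite !pow_add.
        replace (2 ^ m * Cmod z ^ m * (Cmod (a k) * ((1 / 2) ^ m * (1 / 2) ^ (k - m))))
          with (Cmod (a k) * (Cmod z ^ m * (1 / 2) ^ (k - m)) * (2 ^ m * (1 / 2) ^ m)) by ring.
        rewrite <- Rpow_mult_distr. replace (2 * (1 / 2)) with 1 by field. rewrite pow1, Rmult_1_r.
        apply Rmult_le_compat_l; [apply Cmod_ge_0|].
        apply Rmult_le_compat_l; [apply pow_le; auto|]. apply pow_incr; lra.
    - apply (ex_series_scal_l (2 ^ m * Cmod z ^ m) v Hv).
    - apply cser_cv, Hf. lra. }
  rewrite Series_scal_l in B. eapply Rle_trans; [apply B|]. right; ring.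
Qed.

(** * Second-order expansions and the maximum principle *)

Lemma jet_plus (F G : C -> C) (z b c b' c' : C) :
  jet F z b c -> jet G z b' c' -> jet (fun w => F w + G w)%C z (b + b') (c + c').
Proof.
  intros (K & d & HK & Hd & H) (K' & d' & HK' & Hd' & H').
  exists (K + K'), (Rmin d d'). split; [lra|]. split; [now apply Rmin_glb_lt|].
  intros h Hh.
  assert (h1 : Cmod h < d) by (eapply Rlt_le_trans; [apply Hh | apply Rmin_l]).
  assert (h2 : Cmod h < d') by (eapply Rlt_le_trans; [apply Hh | apply Rmin_r]).
  specialize (H h h1); specialize (H' h h2).
  replace (F (z + h) + G (z + h) - (F z + G z + (b + b') * h + (c + c') * h ^ 2))%C
    with ((F (z + h) - (F z + b * h + c * h ^ 2)) + (G (z + h) - (G z + b' * h + c' * h ^ 2)))%C by ring.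
  eapply Rle_trans; [apply Cmod_triangle|]. lra.
Qed.

Lemma jet_local_ext (F G : C -> C) (z b c : C) (d0 : R) :
  0 < d0 -> (forall h, Cmod h < d0 -> F (z + h)%C = G (z + h)%C) ->
  jet F z b c -> jet G z b c.
Proof.
  intros Hd0 E (K & d & HK & Hd & H).
  exists K, (Rmin d d0). split; [lra|]. split; [now apply Rmin_glb_lt|].
  intros h Hh.
  assert (E0 : F z = G z). { rewrite <- (Cplus_0_r z). apply E. rewrite Cmod_0; auto. }
  rewrite <- E0, <- E; [apply H|]; eapply Rlt_le_trans; eauto; [apply Rmin_l | apply Rmin_r].
Qed.

Lemma jet_const (k z : C) : jet (fun _ => k) z 0 0.
Proof.
  exists 0, 1. split; [lra|]. split; [lra|]. intros h _.
  replace (k - (k + 0 * h + 0 * h ^ 2))%C with (RtoC 0) by ring. rewrite Cmod_0; lra.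
Qed.

Lemma jet_id (z : C) : jet (fun w => w) z 1 0.
Proof.
  exists 0, 1. split; [lra|]. split; [lra|]. intros h _.
  replace (z + h - (z + 1 * h + 0 * h ^ 2))%C with (RtoC 0) by ring. rewrite Cmod_0; lra.
Qed.

Lemma quad_bound (a b c h : C) : Cmod h <= 1 ->
  Cmod (a + b * h + c * h ^ 2)%C <= Cmod a + Cmod b + Cmod c.
Proof.
  intros Hh. assert (H0 := Cmod_ge_0 h).
  eapply Rle_trans; [apply Cmod_triangle|]. apply Rplus_le_compat.
  - eapply Rle_trans; [apply Cmod_triangle|]. apply Rplus_le_compat_l.
    rewrite Cmod_mult. assert (H1 := Cmod_ge_0 b). nra.
  - rewrite Cmod_mult, Cmod_pow. assert (H1 := Cmod_ge_0 c).
    assert (Cmod h ^ 2 <= 1) by nra. nra.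
Qed.

Lemma jet_lip (F : C -> C) (z b c : C) : jet F z b c ->
  exists K delta, 0 <= K /\ 0 < delta /\ forall h, Cmod h < delta ->
    Cmod (F (z + h) - F z)%C <= K * Cmod h.
Proof.
  intros (K & d & HK & Hd & H).
  exists (Cmod b + Cmod c + K), (Rmin d 1).
  assert (H1 := Cmod_ge_0 b). assert (H2 := Cmod_ge_0 c).
  split; [lra|]. split; [apply Rmin_glb_lt; lra|].
  intros h Hh.
  assert (h1 : Cmod h < d) by (eapply Rlt_le_trans; [apply Hh | apply Rmin_l]).
  assert (h2 : Cmod h < 1) by (eapply Rlt_le_trans; [apply Hh | apply Rmin_r]).
  specialize (H h h1). assert (H3 := Cmod_ge_0 h).
  replace (F (z + h) - F z)%C with ((F (z + h) - (F z + b * h + c * h ^ 2)) + h * (b + c * h + 0 * h ^ 2))%C by ring.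
  eapply Rle_trans; [apply Cmod_triangle|]. rewrite Cmod_mult.
  assert (B := quad_bound b c 0 h ltac:(lra)). rewrite Cmod_0 in B.
  assert (Cmod h ^ 3 <= Cmod h) by (simpl; nra).
  nra.
Qed.

Lemma jet_bounded (F : C -> C) (z b c : C) : jet F z b c ->
  exists M delta, 0 <= M /\ 0 < delta /\ forall h, Cmod h < delta -> Cmod (F (z + h)%C) <= M.
Proof.
  intros H; destruct (jet_lip _ _ _ _ H) as (K & d & HK & Hd & HL).
  exists (K * d + Cmod (F z)), d. assert (H1 := Cmod_ge_0 (F z)). split; [nra|]. split; [auto|].
  intros h Hh. replace (F (z + h))%C with ((F (z + h) - F z) + F z)%C by ring.
  eapply Rle_trans; [apply Cmod_triangle|]. specialize (HL h Hh). assert (H3 := Cmod_ge_0 h). nra.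
Qed.

Lemma jet_mult (F G : C -> C) (z b c b' c' : C) :
  jet F z b c -> jet G z b' c' ->
  jet (fun w => F w * G w)%C z (F z * b' + b * G z) (F z * c' + b * b' + c * G z).
Proof.
  intros HF HG. destruct (jet_bounded _ _ _ _ HF) as (M & d0 & HM & Hd0 & HB).
  destruct HF as (K & d & HK & Hd & H). destruct HG as (K' & d' & HK' & Hd' & H').
  set (Q := Cmod (G z) + Cmod b' + Cmod c').
  (* The h^3 and h^4 coefficients of the product of the two Taylor polynomials; the zero term fits
     the shape of [quad_bound]. *)
  set (L := Cmod (b * c' + c * b') + Cmod (c * c') + Cmod 0).
  assert (P1 := Cmod_ge_0 (G z)). assert (P2 := Cmod_ge_0 b'). assert (P3 := Cmod_ge_0 c').
  assert (0 <= Q) by (unfold Q; lra).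
  assert (0 <= L). { unfold L. rewrite Cmod_0. assert (A1 := Cmod_ge_0 (b * c' + c * b')). assert (A2 := Cmod_ge_0 (c * c')). lra. }
  exists (M * K' + Q * K + L), (Rmin (Rmin d d') (Rmin d0 1)).
  split. { assert (0 <= M * K') by nra. assert (0 <= Q * K) by nra. lra. }
  split; [repeat apply Rmin_glb_lt; lra|].
  intros h Hh.
  assert (Hh1 : Cmod h < Rmin d d') by (eapply Rlt_le_trans; [apply Hh | apply Rmin_l]).
  assert (Hh2 : Cmod h < Rmin d0 1) by (eapply Rlt_le_trans; [apply Hh | apply Rmin_r]).
  assert (h1 : Cmod h < d) by (eapply Rlt_le_trans; [apply Hh1 | apply Rmin_l]).
  assert (h2 : Cmod h < d') by (eapply Rlt_le_trans; [apply Hh1 | apply Rmin_r]).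
  assert (h3 : Cmod h < d0) by (eapply Rlt_le_trans; [apply Hh2 | apply Rmin_l]).
  assert (h4 : Cmod h < 1) by (eapply Rlt_le_trans; [apply Hh2 | apply Rmin_r]).
  specialize (H h h1); specialize (H' h h2); specialize (HB h h3).
  set (EF := (F (z + h) - (F z + b * h + c * h ^ 2))%C) in *.
  set (EG := (G (z + h) - (G z + b' * h + c' * h ^ 2))%C) in *.
  replace (F (z + h) * G (z + h) - (F z * G z + (F z * b' + b * G z) * h + (F z * c' + b * b' + c * G z) * h ^ 2))%C
    with (F (z + h) * EG + (G z + b' * h + c' * h ^ 2) * EF
          + h ^ 3 * ((b * c' + c * b') + (c * c') * h + 0 * h ^ 2))%C by (unfold EF, EG; ring).
  assert (H3 : 0 <= Cmod h ^ 3) by apply pow_le, Cmod_ge_0.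
  eapply Rle_trans; [apply Cmod_triangle|].
  replace ((M * K' + Q * K + L) * Cmod h ^ 3)
    with (M * (K' * Cmod h ^ 3) + Q * (K * Cmod h ^ 3) + Cmod h ^ 3 * L) by ring.
  apply Rplus_le_compat; [eapply Rle_trans; [apply Cmod_triangle|]; apply Rplus_le_compat|].
  - rewrite Cmod_mult. apply Rmult_le_compat; auto using Cmod_ge_0.
  - rewrite Cmod_mult. apply Rmult_le_compat; auto using Cmod_ge_0. apply quad_bound; lra.
  - rewrite Cmod_mult, Cmod_pow. apply Rmult_le_compat_l; auto. apply quad_bound; lra.
Qed.

(** Let P be the quadratic polynomial with the announced coefficients. They are chosen so that F P =
    1 + O(h^3) by the product rule, and 1/F - P = -(F P - 1)/F, where |F| stays above |F z|/2 near
    z. *)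
Lemma jet_inv (F : C -> C) (z b c : C) :
  jet F z b c -> F z <> 0%C ->
  jet (fun w => / F w)%C z (- b / F z ^ 2) ((b ^ 2 - F z * c) / F z ^ 3).
Proof.
  intros HF Hz.
  set (A := (/ F z)%C). set (B := (- b / F z ^ 2)%C). set (D := ((b ^ 2 - F z * c) / F z ^ 3)%C).
  set (P := fun w => (A + B * (w - z) + D * (w - z) ^ 2)%C).
  assert (HP : jet P z B D).
  { exists 0, 1. split; [lra|]. split; [lra|]. intros h _. unfold P.
    match goal with |- Cmod ?x <= _ => replace x with (RtoC 0) by ring end. rewrite Cmod_0; lra. }
  assert (HM := jet_mult _ _ _ _ _ _ _ HF HP).
  destruct HM as (K & d & HK & Hd & H).
  destruct (jet_lip _ _ _ _ HF) as (K' & d' & HK' & Hd' & HL).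
  set (m := Cmod (F z)). assert (Hm : 0 < m) by (apply Cmod_gt_0; auto).
  set (r := m / (2 * (K' + 1))). assert (Hr : 0 < r) by (apply Rdiv_lt_0_compat; lra).
  exists (2 / m * K), (Rmin (Rmin d d') r).
  split. { apply Rmult_le_pos; auto. apply Rlt_le, Rdiv_lt_0_compat; lra. }
  split; [repeat apply Rmin_glb_lt; lra|].
  intros h Hh.
  assert (Hh1 : Cmod h < Rmin d d') by (eapply Rlt_le_trans; [apply Hh | apply Rmin_l]).
  assert (h3 : Cmod h < r) by (eapply Rlt_le_trans; [apply Hh | apply Rmin_r]).
  assert (h1 : Cmod h < d) by (eapply Rlt_le_trans; [apply Hh1 | apply Rmin_l]).
  assert (h2 : Cmod h < d') by (eapply Rlt_le_trans; [apply Hh1 | apply Rmin_r]).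
  specialize (H h h1); specialize (HL h h2).
  assert (P3 := Cmod_ge_0 h).
  assert (Hlow : m / 2 <= Cmod (F (z + h)%C)).
  { assert (T := Cmod_triangle (F (z + h)%C) (- (F (z + h) - F z))%C).
    replace (F (z + h) + - (F (z + h) - F z))%C with (F z) in T by ring.
    rewrite Cmod_opp in T. fold m in T.
    assert (K' * Cmod h <= m / 2).
    { apply Rle_trans with ((K' + 1) * r); [nra|]. unfold r. right; field; lra. }
    lra. }
  assert (Hne : F (z + h)%C <> 0%C) by (intros E; rewrite E, Cmod_0 in Hlow; lra).
  replace (/ F (z + h) - (/ F z + B * h + D * h ^ 2))%C
    with (- (F (z + h) * P (z + h) - (F z * P z + (F z * B + b * P z) * h + (F z * D + b * B + c * P z) * h ^ 2)) / F (z + h))%C.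
  2: { unfold P, A, B, D. field. auto. }
  rewrite Cmod_div, Cmod_opp by auto.
  assert (H3 : 0 <= Cmod h ^ 3) by apply pow_le, Cmod_ge_0.
  apply Rle_trans with (K * Cmod h ^ 3 / (m / 2)).
  - unfold Rdiv at 1 2. apply Rmult_le_compat; auto using Cmod_ge_0.
    + apply Rlt_le, Rinv_0_lt_compat. lra.
    + apply Rinv_le_contravar; lra.
  - right. field. lra.
Qed.

(** Only the derivative is tracked; of the second coefficient, the maximum principle uses the mere
    existence. *)
Definition ana (F : C -> C) (z b : C) : Prop := exists c, jet F z b c.

Lemma ana_local_ext (F G : C -> C) (z b : C) (d0 : R) :
  0 < d0 -> (forall h, Cmod h < d0 -> F (z + h)%C = G (z + h)%C) ->
  ana F z b -> ana G z b.
Proof. intros H1 H2 [c H]. exists c. eapply jet_local_ext; eauto. Qed.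

Lemma ana_const (k z : C) : ana (fun _ => k) z 0.
Proof. exists 0%C. apply jet_const. Qed.

Lemma ana_id (z : C) : ana (fun w => w) z 1.
Proof. exists 0%C. apply jet_id. Qed.

Lemma ana_plus (F G : C -> C) (z b b' : C) :
  ana F z b -> ana G z b' -> ana (fun w => F w + G w)%C z (b + b').
Proof. intros [c H] [c' H']. eexists. apply jet_plus; eauto. Qed.

Lemma ana_mult (F G : C -> C) (z b b' : C) :
  ana F z b -> ana G z b' -> ana (fun w => F w * G w)%C z (F z * b' + b * G z).
Proof. intros [c H] [c' H']. eexists. apply jet_mult; eauto. Qed.

Lemma ana_inv (F : C -> C) (z b : C) :
  ana F z b -> F z <> 0%C -> ana (fun w => / F w)%C z (- b / F z ^ 2).
Proof. intros [c H] Hz. eexists. apply jet_inv; eauto. Qed.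

Lemma ana_ext (F G : C -> C) (z b b' : C) :
  (forall w, F w = G w) -> b = b' -> ana F z b -> ana G z b'.
Proof.
  intros H <- HF. apply (ana_local_ext F G z b 1); auto. lra.
Qed.

Lemma ana_minus (F G : C -> C) (z b b' : C) :
  ana F z b -> ana G z b' -> ana (fun w => F w - G w)%C z (b - b').
Proof.
  intros H H'. eapply ana_ext; [| |exact (ana_plus _ _ _ _ _ H (ana_mult _ _ _ _ _ (ana_const (-(1))%C z) H'))].
  - intros w; simpl; ring.
  - simpl; ring.
Qed.

Lemma ana_div (F G : C -> C) (z b b' : C) :
  ana F z b -> ana G z b' -> G z <> 0%C ->
  ana (fun w => F w / G w)%C z ((b * G z - F z * b') / G z ^ 2).
Proof.
  intros H H' Hz. eapply ana_ext; [| |exact (ana_mult _ _ _ _ _ H (ana_inv _ _ _ H' Hz))].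
  - intros w; simpl; reflexivity.
  - simpl; field; auto.
Qed.

Lemma ana_pow (F : C -> C) (z b : C) (k : nat) :
  ana F z b -> ana (fun w => F w ^ k)%C z (RtoC (INR k) * F z ^ (pred k) * b).
Proof.
  intros H. induction k as [|k IH].
  - eapply ana_ext; [| |apply (ana_const 1%C)]; simpl; intros; ring.
  - eapply ana_ext; [| |exact (ana_mult _ _ _ _ _ H IH)].
    + intros w; reflexivity.
    + rewrite S_INR, RtoC_plus. destruct k as [|k]; simpl; ring.
Qed.

Lemma ana_continuous (F : C -> C) (z b : C) : ana F z b ->
  forall eps, 0 < eps -> exists delta, 0 < delta /\
    forall w, Cmod (w - z) < delta -> Cmod (F w - F z) < eps.
Proof.
  intros [c H] eps He. destruct (jet_lip _ _ _ _ H) as (K & d & HK & Hd & HL).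
  exists (Rmin d (eps / (K + 1))).
  assert (0 < eps / (K + 1)) by (apply Rdiv_lt_0_compat; lra).
  split; [apply Rmin_glb_lt; lra|]. intros w Hw.
  assert (h1 : Cmod (w - z) < d) by (eapply Rlt_le_trans; [apply Hw | apply Rmin_l]).
  assert (h2 : Cmod (w - z) < eps / (K + 1)) by (eapply Rlt_le_trans; [apply Hw | apply Rmin_r]).
  specialize (HL _ h1). replace (z + (w - z))%C with w in HL by ring.
  assert (P := Cmod_ge_0 (w - z)).
  assert (eps = (K + 1) * (eps / (K + 1))) by (field; lra). nra.
Qed.

(** * Maximum principle on closed discs *)

Lemma Cmod_sqr_add_ge (P E : C) : Cmod P ^ 2 - 2 * Cmod P * Cmod E <= Cmod (P + E)%C ^ 2.
Proof.
  assert (H := Cmod_triangle (P + E)%C (- E)%C). rewrite Cmod_opp in H.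
  replace (P + E + - E)%C with P in H by ring.
  assert (H1 := Cmod_ge_0 P). assert (H2 := Cmod_ge_0 E). assert (H3 := Cmod_ge_0 (P + E)%C).
  destruct (Rle_lt_dec (Cmod P) (Cmod E)); nra.
Qed.

(* Averaging |F|^2 + eps |.|^2 over z + t, z - t, z + it, z - it leaves eps t^2 + O(t^3). *)
Lemma no_interior_max (F : C -> C) (z b : C) (eps d : R) :
  ana F z b -> 0 < eps -> 0 < d ->
  exists h, Cmod h < d /\
    Cmod (F z) ^ 2 + eps * Cmod z ^ 2 < Cmod (F (z + h)%C) ^ 2 + eps * Cmod (z + h)%C ^ 2.
Proof.
  intros [c (K & d' & HK & Hd' & H)] He Hd.
  apply NNPP; intros HN.
  assert (HA : forall h, Cmod h < d -> Cmod (F (z + h)%C) ^ 2 + eps * Cmod (z + h)%C ^ 2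
                 <= Cmod (F z) ^ 2 + eps * Cmod z ^ 2).
  { intros h Hh. apply Rnot_lt_le. intros Hl. apply HN. exists h; auto. }
  clear HN.
  set (M := Cmod (F z) + Cmod b + Cmod c).
  assert (HM : 0 <= M).
  { unfold M. assert (Q1 := Cmod_ge_0 (F z)). assert (Q2 := Cmod_ge_0 b). assert (Q3 := Cmod_ge_0 c). lra. }
  (* The last bound gives 2 M K t < eps, which contradicts the averaged inequality; the factor 1/2
     makes all the bounds strict. *)
  set (t := / 2 * Rmin (Rmin d d') (Rmin 1 (eps / (2 * M * K + 1)))).
  assert (HMK : 0 <= M * K) by nra.
  assert (He' : 0 < eps / (2 * M * K + 1)) by (apply Rdiv_lt_0_compat; nra).
  assert (Hmin : 0 < Rmin (Rmin d d') (Rmin 1 (eps / (2 * M * K + 1)))) by (repeat apply Rmin_glb_lt; lra).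
  assert (Ht : 0 < t) by (unfold t; lra).
  assert (L1 := Rmin_l (Rmin d d') (Rmin 1 (eps / (2 * M * K + 1)))).
  assert (L2 := Rmin_r (Rmin d d') (Rmin 1 (eps / (2 * M * K + 1)))).
  assert (L3 := Rmin_l d d'). assert (L4 := Rmin_r d d').
  assert (L5 := Rmin_l 1 (eps / (2 * M * K + 1))). assert (L6 := Rmin_r 1 (eps / (2 * M * K + 1))).
  assert (T1 : t < d) by (unfold t; lra). assert (T2 : t < d') by (unfold t; lra).
  assert (T3 : t < 1) by (unfold t; lra). assert (T4 : t < eps / (2 * M * K + 1)) by (unfold t; lra).
  set (P := fun h => (F z + b * h + c * h ^ 2)%C).
  assert (S : forall h, Cmod h = t -> Cmod (P h) ^ 2 + eps * Cmod (z + h)%C ^ 2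
      <= Cmod (F z) ^ 2 + eps * Cmod z ^ 2 + 2 * M * (K * t ^ 3)).
  { intros h Hh. specialize (HA h ltac:(lra)). specialize (H h ltac:(lra)).
    assert (Q := Cmod_sqr_add_ge (P h) (F (z + h) - (F z + b * h + c * h ^ 2))%C).
    replace (P h + (F (z + h) - (F z + b * h + c * h ^ 2)))%C with (F (z + h))%C in Q by (unfold P; ring).
    rewrite Hh in H.
    assert (Q2 : Cmod (P h) <= M) by (apply quad_bound; lra).
    assert (Q3 := Cmod_ge_0 (P h)). assert (Q4 := Cmod_ge_0 (F (z + h) - (F z + b * h + c * h ^ 2))%C).
    assert (Cmod (P h) * Cmod (F (z + h) - (F z + b * h + c * h ^ 2))%C <= M * (K * t ^ 3))
      by (apply Rmult_le_compat; auto).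
    lra. }
  assert (C1' : Cmod (RtoC t) = t) by (rewrite Cmod_R, Rabs_pos_eq; lra).
  assert (S1 := S (RtoC t) C1').
  assert (S2 := S (- RtoC t)%C ltac:(rewrite Cmod_opp; auto)).
  assert (S3 := S (Ci * RtoC t)%C ltac:(rewrite Cmod_mult, Cmod_Ci; lra)).
  assert (S4 := S (- (Ci * RtoC t))%C ltac:(rewrite Cmod_opp, Cmod_mult, Cmod_Ci; lra)).
  (* Four points are used rather than two: h and h^2 both sum to zero over them, so the cross terms
     with c vanish too. *)
  assert (Hsum : Cmod (P (RtoC t)) ^ 2 + Cmod (P (- RtoC t)%C) ^ 2 + Cmod (P (Ci * RtoC t)%C) ^ 2
       + Cmod (P (- (Ci * RtoC t))%C) ^ 2 = 4 * Cmod (F z) ^ 2 + 4 * Cmod b ^ 2 * t ^ 2 + 4 * Cmod c ^ 2 * t ^ 4).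
  { rewrite !Cmod2_alt. unfold P, Ci, RtoC, Cplus, Cmult, Copp, Re, Im, Cpow.
    destruct (F z), b, c; simpl. ring. }
  assert (Hsum' : Cmod (z + RtoC t)%C ^ 2 + Cmod (z + - RtoC t)%C ^ 2 + Cmod (z + Ci * RtoC t)%C ^ 2
       + Cmod (z + - (Ci * RtoC t))%C ^ 2 = 4 * Cmod z ^ 2 + 4 * t ^ 2).
  { rewrite !Cmod2_alt. unfold Ci, RtoC, Cplus, Cmult, Copp, Re, Im. destruct z; simpl. ring. }
  assert (0 <= Cmod b ^ 2 * t ^ 2) by (apply Rmult_le_pos; apply pow2_ge_0).
  assert (0 <= Cmod c ^ 2 * t ^ 4) by (apply Rmult_le_pos; [apply pow2_ge_0 | apply pow_le; lra]).
  assert (Hfin : eps * t ^ 2 <= 2 * M * (K * t ^ 3)) by nra.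
  assert (Hfin2 : eps <= 2 * M * K * t).
  { apply Rmult_le_reg_r with (t ^ 2); [apply pow_lt; lra|]. lra. }
  assert (eps = (2 * M * K + 1) * (eps / (2 * M * K + 1))) by (field; nra).
  nra.
Qed.

(** Local bounds become a global one by compactness of the square [-r, r]^2. Each point receives one
    positive number that is both the size of a neighbourhood and the inverse of a bound there, so a
    uniform lower bound on these numbers bounds H. Points outside the disc receive half their
    distance to it, and their neighbourhoods miss the disc. *)
Lemma disc_bounded (H : C -> R) (r : R) :
  (forall z, Cmod z <= r -> exists B d, 0 < d /\ forall w, Cmod w <= r -> Cmod (w - z) < d -> H w <= B) ->
  exists B, forall w, Cmod w <= r -> H w <= B.
Proof.
  intros HL.
  assert (HD : forall u v : R, exists d : posreal, forall w : C, Cmod w <= r ->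
     Rabs (fst w - u) < d -> Rabs (snd w - v) < d -> H w <= / d).
  { intros u v.
    assert (HC : forall (w : C) (e : R), Rabs (fst w - u) < e / 2 -> Rabs (snd w - v) < e / 2 ->
              Cmod (w - (u, v))%C < e).
    { intros w e H1 H2. eapply Rle_lt_trans; [apply Cmod_le_abs|]. simpl.
      unfold Rminus in *. lra. }
    destruct (Rle_lt_dec (Cmod (u, v)) r) as [Hin|Hout].
    - destruct (HL (u, v) Hin) as (B & d & Hd & HB).
      set (e := Rmin (d / 2) (/ (Rabs B + 1))).
      assert (HB0 := Rabs_pos B).
      assert (He : 0 < e). { apply Rmin_glb_lt; [lra|]. apply Rinv_0_lt_compat; lra. }
      exists (mkposreal e He). simpl. intros w Hw H1 H2.
      apply Rle_trans with B.
      + apply HB; auto. apply HC; eapply Rlt_le_trans; eauto; apply Rmin_l.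
      + apply Rle_trans with (Rabs B + 1); [assert (Q := Rle_abs B); lra|].
        rewrite <- (Rinv_inv (Rabs B + 1)). apply Rinv_le_contravar; auto. apply Rmin_r.
    - assert (He : 0 < (Cmod (u, v) - r) / 2) by lra.
      exists (mkposreal _ He). simpl. intros w Hw H1 H2. exfalso.
      assert (Q := HC w _ H1 H2).
      assert (T := Cmod_triangle w (- (w - (u, v)))%C). rewrite Cmod_opp in T.
      replace (w + - (w - (u, v)))%C with ((u, v) : C) in T
        by (destruct w; unfold Cminus, Cplus, Copp; simpl; f_equal; ring). lra. }
  assert (HS : forall p : R * R, {d : posreal | forall w : C, Cmod w <= r ->
     Rabs (fst w - fst p) < d -> Rabs (snd w - snd p) < d -> H w <= / d}).
  { intros p. apply constructive_indefinite_description, HD. }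
  destruct (compactness_value_2d (-r) r (-r) r (fun u v => proj1_sig (HS (u, v)))) as [d Hd].
  exists (/ d). intros w Hw.
  assert (W1 := fst_le_Cmod w). assert (W2 := snd_le_Cmod w).
  assert (X1 := Rabs_le_between (fst w) r). assert (X2 := Rabs_le_between (snd w) r).
  specialize (Hd (fst w) (snd w) ltac:(apply X1; lra) ltac:(apply X2; lra)).
  apply NNPP in Hd. destruct Hd as (u & v & _ & _ & H1 & H2 & H3).
  destruct (HS (u, v)) as [e HE]; simpl in *.
  eapply Rle_trans; [apply HE; auto|]. apply Rinv_le_contravar; auto. apply cond_pos.
Qed.

(** If the supremum S were not attained, 1/(S - G) would be locally bounded, hence bounded by some
    B', and S - 1/B' would be a smaller upper bound. *)
Lemma disc_max (G : C -> R) (r : R) : 0 <= r ->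
  (forall z, Cmod z <= r -> forall eps, 0 < eps -> exists d, 0 < d /\
     forall w, Cmod w <= r -> Cmod (w - z) < d -> Rabs (G w - G z) < eps) ->
  exists z, Cmod z <= r /\ forall w, Cmod w <= r -> G w <= G z.
Proof.
  intros Hr Hc.
  destruct (disc_bounded G r) as [B HB].
  { intros z Hz. destruct (Hc z Hz 1 Rlt_0_1) as (d & Hd & H).
    exists (G z + 1), d. split; auto. intros w Hw Hwz. specialize (H w Hw Hwz).
    apply Rabs_def2 in H. lra. }
  destruct (completeness (fun x => exists w, Cmod w <= r /\ x = G w)) as [S [HS1 HS2]].
  { exists B. intros x (w & Hw & ->). auto. }
  { exists (G 0%C), 0%C. rewrite Cmod_0; auto. }
  apply NNPP; intros HN.
  assert (HSlt : forall z, Cmod z <= r -> G z < S).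
  { intros z Hz. assert (G z <= S) by (apply HS1; eauto).
    destruct (Req_dec (G z) S) as [E|]; [|lra]. exfalso; apply HN. exists z; split; auto.
    intros w Hw. rewrite E. apply HS1; eauto. }
  destruct (disc_bounded (fun z => / (S - G z)) r) as [B' HB'].
  { intros z Hz. assert (HG := HSlt z Hz).
    destruct (Hc z Hz ((S - G z) / 2) ltac:(lra)) as (d & Hd & H).
    exists (/ ((S - G z) / 2)), d. split; auto. intros w Hw Hwz. specialize (H w Hw Hwz).
    apply Rabs_def2 in H. apply Rinv_le_contravar; lra. }
  assert (HB0 : 0 < B').
  { eapply Rlt_le_trans; [|apply (HB' 0%C); rewrite Cmod_0; auto].
    apply Rinv_0_lt_compat. assert (Q := HSlt 0%C). rewrite Cmod_0 in Q. specialize (Q Hr). lra. }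
  assert (HBi : 0 < / B') by (apply Rinv_0_lt_compat; auto).
  assert (S <= S - / B'); [|lra].
  apply HS2. intros x (w & Hw & ->). specialize (HB' w Hw). assert (HG := HSlt w Hw).
  assert (/ B' <= S - G w); [|lra].
  rewrite <- (Rinv_inv (S - G w)). apply Rinv_le_contravar; auto.
  apply Rinv_0_lt_compat; lra.
Qed.

(** On S the function is merely continuous, but it vanishes there. A maximum point of |F|^2 + eps
    |z|^2 on the closed disc lies in S or on the circle, since [no_interior_max] excludes the rest;
    in both cases |F| <= M at that point, and eps tends to 0. *)
Lemma max_principle (F : C -> C) (S : C -> Prop) (r M : R) : 0 < r -> 0 <= M ->
  (forall z, Cmod z <= r -> forall eps, 0 < eps -> exists d, 0 < d /\
     forall w, Cmod (w - z) < d -> Cmod (F w - F z) < eps) ->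
  (forall z, S z -> F z = 0%C) ->
  (forall z, Cmod z < r -> ~ S z -> exists b, ana F z b) ->
  (forall z, Cmod z = r -> Cmod (F z) <= M) ->
  forall z, Cmod z <= r -> Cmod (F z) <= M.
Proof.
  intros Hr HM Hc HS Ha Hb z Hz.
  assert (HE : forall eps, 0 < eps -> Cmod (F z) ^ 2 <= M ^ 2 + eps).
  { intros eps0 He0. set (eps := eps0 / r ^ 2).
    assert (Hr2 : 0 < r ^ 2) by (apply pow_lt; auto).
    assert (He : 0 < eps) by (apply Rdiv_lt_0_compat; auto).
    assert (Heq : eps * r ^ 2 = eps0) by (unfold eps; field; lra).
    destruct (disc_max (fun w => Cmod (F w) ^ 2 + eps * Cmod w ^ 2) r) as (y & Hy & HyM).
    { lra. }
    { intros y Hy e Hepos.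
      set (L := 2 * Cmod (F y) + 1). assert (Q0 := Cmod_ge_0 (F y)).
      assert (HL : 0 < L) by (unfold L; lra).
      destruct (Hc y Hy (Rmin 1 (e / 2 / L))) as (d & Hd & H).
      { apply Rmin_glb_lt; [lra|]. apply Rdiv_lt_0_compat; lra. }
      set (d2 := e / 2 / (eps * (2 * r) + 1)).
      assert (Hden : 0 < eps * (2 * r) + 1) by nra.
      assert (Hd2 : 0 < d2) by (apply Rdiv_lt_0_compat; lra).
      exists (Rmin d d2). split; [now apply Rmin_glb_lt|].
      intros w Hw Hwy.
      assert (h1 : Cmod (w - y) < d) by (eapply Rlt_le_trans; [apply Hwy | apply Rmin_l]).
      assert (h2 : Cmod (w - y) < d2) by (eapply Rlt_le_trans; [apply Hwy | apply Rmin_r]).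
      specialize (H w h1).
      assert (k1 : Cmod (F w - F y) < 1) by (eapply Rlt_le_trans; [apply H | apply Rmin_l]).
      assert (k2 : Cmod (F w - F y) < e / 2 / L) by (eapply Rlt_le_trans; [apply H | apply Rmin_r]).
      assert (Sub : forall p q : C, Rabs (Cmod p - Cmod q) <= Cmod (p - q)).
      { intros p q. assert (T1 := Cmod_triangle (p - q)%C q). assert (T2 := Cmod_triangle (-(p - q))%C p).
        rewrite Cmod_opp in T2. replace (p - q + q)%C with p in T1 by ring.
        replace (- (p - q) + p)%C with q in T2 by ring. apply Rabs_le; lra. }
      assert (R1 := Sub (F w) (F y)). assert (R2 := Sub w y).
      assert (P1 := Cmod_ge_0 (F w)). assert (P2 := Cmod_ge_0 w). assert (P3 := Cmod_ge_0 y).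
      replace (Cmod (F w) ^ 2 + eps * Cmod w ^ 2 - (Cmod (F y) ^ 2 + eps * Cmod y ^ 2))
        with ((Cmod (F w) - Cmod (F y)) * (Cmod (F w) + Cmod (F y))
              + eps * ((Cmod w - Cmod y) * (Cmod w + Cmod y))) by ring.
      eapply Rle_lt_trans; [apply Rabs_triang|].
      rewrite !Rabs_mult, (Rabs_pos_eq eps), (Rabs_pos_eq (Cmod (F w) + Cmod (F y))),
        (Rabs_pos_eq (Cmod w + Cmod y)) by lra.
      assert (A1 : Rabs (Cmod (F w) - Cmod (F y)) * (Cmod (F w) + Cmod (F y)) < e / 2).
      { apply Rabs_le_between in R1 as R1'.
        apply Rle_lt_trans with (Cmod (F w - F y) * L).
        - apply Rmult_le_compat; try apply Rabs_pos; unfold L; lra.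
        - apply Rlt_div_r in k2; auto. }
      assert (A2 : eps * (Rabs (Cmod w - Cmod y) * (Cmod w + Cmod y)) <= e / 2).
      { apply Rle_trans with (eps * (d2 * (2 * r))).
        - apply Rmult_le_compat_l; [lra|]. apply Rmult_le_compat; try apply Rabs_pos; lra.
        - apply Rle_trans with (d2 * (eps * (2 * r) + 1)); [nra|]. unfold d2. right; field; lra. }
      lra. }
    assert (Hfin : Cmod (F y) ^ 2 + eps * Cmod y ^ 2 <= M ^ 2 + eps0).
    { assert (Qy := Cmod_ge_0 y).
      assert (Cmod y ^ 2 <= r ^ 2) by (apply pow_incr; lra).
      assert (eps * Cmod y ^ 2 <= eps0) by (rewrite <- Heq; apply Rmult_le_compat_l; lra).
      assert (Cmod (F y) ^ 2 <= M ^ 2); [|lra].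
      destruct (classic (S y)) as [HSy|HSy].
      { rewrite (HS y HSy), Cmod_0. nra. }
      apply pow_incr. split; [apply Cmod_ge_0|].
      destruct (Req_dec (Cmod y) r) as [E|E]; [auto|]. exfalso.
      destruct (Ha y ltac:(lra) HSy) as [b Hb'].
      destruct (no_interior_max F y b eps (r - Cmod y) Hb' He ltac:(lra)) as (h & Hh & Hlt).
      assert (T := Cmod_triangle y h). specialize (HyM (y + h)%C ltac:(lra)). simpl in HyM, Hlt. lra. }
    specialize (HyM z Hz). simpl in HyM, Hfin |- *.
    assert (0 <= eps * (Cmod z * (Cmod z * 1))).
    { apply Rmult_le_pos; [lra|]. assert (Q := Cmod_ge_0 z). nra. }
    lra. }
  assert (HF := Cmod_ge_0 (F z)).
  apply Rnot_lt_le; intros Hlt. specialize (HE ((Cmod (F z) ^ 2 - M ^ 2) / 2)).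
  assert (0 < Cmod (F z) ^ 2 - M ^ 2) by nra. lra.
Qed.

(** * Schwarz and Schwarz-Pick lemmas *)

Lemma Cmod_sub_le (p q : C) : Cmod p - Cmod q <= Cmod (p - q).
Proof.
  assert (T := Cmod_triangle (p - q)%C q). replace (p - q + q)%C with p in T by ring. lra.
Qed.

Lemma Cmod_minus_sym (p q : C) : Cmod (p - q) = Cmod (q - p).
Proof. rewrite <- Cmod_opp. f_equal. ring. Qed.

Lemma Cmod_minus_le (p q : C) : Cmod (p - q) <= Cmod p + Cmod q.
Proof. eapply Rle_trans; [apply Cmod_triangle|]. rewrite Cmod_opp. lra. Qed.

Lemma continuous_at_zero (P : C -> C) (y : C) (L d0 : R) :
  0 <= L -> 0 < d0 -> P y = 0%C ->
  (forall w, Cmod (w - y) < d0 -> Cmod (P w) <= L * Cmod (w - y)) ->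
  forall eps, 0 < eps -> exists d, 0 < d /\
     forall w, Cmod (w - y) < d -> Cmod (P w - P y) < eps.
Proof.
  intros HL Hd0 Hy HB eps He.
  exists (Rmin d0 (eps / (L + 1))).
  assert (0 < eps / (L + 1)) by (apply Rdiv_lt_0_compat; lra).
  split; [apply Rmin_glb_lt; lra|]. intros w Hw.
  assert (h1 : Cmod (w - y) < d0) by (eapply Rlt_le_trans; [apply Hw | apply Rmin_l]).
  assert (h2 : Cmod (w - y) < eps / (L + 1)) by (eapply Rlt_le_trans; [apply Hw | apply Rmin_r]).
  specialize (HB w h1). rewrite Hy. replace (P w - 0)%C with (P w) by ring.
  assert (Q := Cmod_ge_0 (w - y)).
  assert (eps = (L + 1) * (eps / (L + 1))) by (field; lra). nra.
Qed.

(** Nothing is asked at [a] and [b] themselves, where a quotient has only the conventional value of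
    a division by zero. *)
Definition bounded_near (F : C -> C) (a b y : C) : Prop :=
  exists K d, 0 <= K /\ 0 < d /\ forall w, Cmod w < 1 -> w <> a -> w <> b ->
    Cmod (w - y) < d -> Cmod (F w) <= K.

(* The factor (z - a)(z - b) kills the two punctures, and its influence disappears
   as N -> oo in the maximum principle for F^N (z - a)(z - b). *)
Lemma punctured_max_principle (F : C -> C) (a b : C) :
  (forall z, Cmod z < 1 -> z <> a -> z <> b -> exists c, ana F z c) ->
  bounded_near F a b a -> bounded_near F a b b ->
  (forall eps, 0 < eps -> exists r0, r0 < 1 /\
     forall z, r0 <= Cmod z < 1 -> z <> a -> z <> b -> Cmod (F z) <= 1 + eps) ->
  forall z, Cmod z < 1 -> z <> a -> z <> b -> Cmod (F z) <= 1.
Proof.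
  intros Ha Hna Hnb Hbd z Hz Hza Hzb.
  apply Rnot_lt_le; intros Hlt.
  set (eps := (Cmod (F z) - 1) / 2).
  assert (He : 0 < eps) by (unfold eps; lra).
  destruct (Hbd eps He) as (r0 & Hr0 & HB).
  set (r := Rmax (Rmax r0 (Cmod z)) (1 / 2)).
  assert (Hr1 : r < 1) by (unfold r; repeat apply Rmax_lub_lt; lra).
  assert (Hrz : Cmod z <= r) by (unfold r; eapply Rle_trans; [apply Rmax_r | apply Rmax_l]).
  assert (Hrr : r0 <= r) by (unfold r; eapply Rle_trans; [apply Rmax_l | apply Rmax_l]).
  assert (Hrp : 0 < r) by (assert (Q := Rmax_r (Rmax r0 (Cmod z)) (1 / 2)); unfold r; lra).
  set (M0 := (1 + Cmod a) * (1 + Cmod b)).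
  assert (A0 := Cmod_ge_0 a). assert (B0 := Cmod_ge_0 b).
  assert (HM0 : 0 <= M0) by (unfold M0; nra).
  assert (HN : forall N, Cmod (F z) ^ N * (Cmod (z - a) * Cmod (z - b)) <= (1 + eps) ^ N * M0).
  { intros N.
    set (P := fun w => (F w ^ N * ((w - a) * (w - b)))%C).
    assert (HPm : forall w, Cmod (P w) = Cmod (F w) ^ N * (Cmod (w - a) * Cmod (w - b))).
    { intros w; unfold P. rewrite !Cmod_mult, Cmod_pow. ring. }
    assert (HPa : P a = 0%C) by (unfold P; ring).
    assert (HPb : P b = 0%C) by (unfold P; ring).
    assert (HPan : forall w, Cmod w < 1 -> ~ (w = a \/ w = b) -> exists c, ana P w c).
    { intros w Hw Hwn. destruct (Ha w Hw) as [c Hc]; [tauto|tauto|].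
      eexists. unfold P. apply ana_mult; [apply ana_pow, Hc|].
      apply ana_mult; apply ana_minus; (apply ana_id || apply ana_const). }
    assert (HPne : forall y L d0, 0 <= L -> 0 < d0 -> P y = 0%C ->
        (forall w, w <> a -> w <> b -> Cmod (w - y) < d0 -> Cmod (P w) <= L * Cmod (w - y)) ->
        forall e, 0 < e -> exists d, 0 < d /\
          forall w, Cmod (w - y) < d -> Cmod (P w - P y) < e).
    { intros y L d0 HL Hd0 Hy HPy. apply (continuous_at_zero P y L d0); auto.
      intros w Hw. assert (Q := Cmod_ge_0 (w - y)).
      destruct (classic (w = a)) as [->|Hwa]; [rewrite HPa, Cmod_0; nra|].
      destruct (classic (w = b)) as [->|Hwb]; [rewrite HPb, Cmod_0; nra|]. auto. }
    rewrite <- HPm.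
    apply (max_principle P (fun w => w = a \/ w = b) r); auto.
    - apply Rmult_le_pos; auto. apply pow_le; lra.
    - intros w Hw.
      destruct (classic (w = a)) as [->|Hwa].
      { destruct Hna as (K & d & HK & Hd & H).
        assert (HKN : 0 <= K ^ N) by (apply pow_le; auto).
        apply (HPne a (K ^ N * (1 + Cmod b)) (Rmin d (1 - Cmod a))); auto.
        - apply Rmult_le_pos; lra.
        - apply Rmin_glb_lt; lra.
        - intros w Hwa Hwb Hd'. rewrite HPm.
          assert (h1 : Cmod (w - a) < d) by (eapply Rlt_le_trans; [apply Hd' | apply Rmin_l]).
          assert (h2 : Cmod (w - a) < 1 - Cmod a) by (eapply Rlt_le_trans; [apply Hd' | apply Rmin_r]).
          assert (h3 := Cmod_sub_le w a). assert (h4 := Cmod_minus_le w b).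
          assert (h5 := Cmod_ge_0 (w - a)).
          replace (K ^ N * (1 + Cmod b) * Cmod (w - a)) with (K ^ N * (Cmod (w - a) * (1 + Cmod b))) by ring.
          apply Rmult_le_compat; [apply pow_le, Cmod_ge_0| | |].
          + apply Rmult_le_pos; apply Cmod_ge_0.
          + apply pow_incr. split; [apply Cmod_ge_0|]. apply H; auto. lra.
          + apply Rmult_le_compat_l; lra. }
      destruct (classic (w = b)) as [->|Hwb].
      { destruct Hnb as (K & d & HK & Hd & H).
        assert (HKN : 0 <= K ^ N) by (apply pow_le; auto).
        apply (HPne b (K ^ N * (1 + Cmod a)) (Rmin d (1 - Cmod b))); auto.
        - apply Rmult_le_pos; lra.
        - apply Rmin_glb_lt; lra.
        - intros w Hwa' Hwb Hd'. rewrite HPm.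
          assert (h1 : Cmod (w - b) < d) by (eapply Rlt_le_trans; [apply Hd' | apply Rmin_l]).
          assert (h2 : Cmod (w - b) < 1 - Cmod b) by (eapply Rlt_le_trans; [apply Hd' | apply Rmin_r]).
          assert (h3 := Cmod_sub_le w b). assert (h4 := Cmod_minus_le w a).
          assert (h5 := Cmod_ge_0 (w - b)).
          replace (K ^ N * (1 + Cmod a) * Cmod (w - b)) with (K ^ N * ((1 + Cmod a) * Cmod (w - b))) by ring.
          apply Rmult_le_compat; [apply pow_le, Cmod_ge_0| | |].
          + apply Rmult_le_pos; apply Cmod_ge_0.
          + apply pow_incr. split; [apply Cmod_ge_0|]. apply H; auto. lra.
          + apply Rmult_le_compat_r; lra. }
      destruct (HPan w ltac:(lra) ltac:(tauto)) as [c Hc]. exact (ana_continuous _ _ _ Hc).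
    - intros w [->| ->]; auto.
    - intros w Hw; apply HPan; lra.
    - intros w Hw.
      assert (Hpos : 0 <= (1 + eps) ^ N * M0) by (apply Rmult_le_pos; auto; apply pow_le; lra).
      destruct (classic (w = a)) as [->|Hwa]; [rewrite HPa, Cmod_0; auto|].
      destruct (classic (w = b)) as [->|Hwb]; [rewrite HPb, Cmod_0; auto|].
      rewrite HPm. assert (h4 := Cmod_minus_le w b). assert (h3 := Cmod_minus_le w a).
      apply Rmult_le_compat; [apply pow_le, Cmod_ge_0| | |].
      + apply Rmult_le_pos; apply Cmod_ge_0.
      + apply pow_incr. split; [apply Cmod_ge_0|]. apply HB; auto; lra.
      + unfold M0. apply Rmult_le_compat; try apply Cmod_ge_0; lra. }
  (* As [eps] is half the excess of |F z| over 1, q > 1, so q^N m <= M0 fails for large N. *)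
  set (q := Cmod (F z) / (1 + eps)).
  assert (Hq : 1 < q) by (unfold q; apply Rlt_div_r; unfold eps; lra).
  set (m := Cmod (z - a) * Cmod (z - b)).
  assert (Hm : 0 < m).
  { apply Rmult_lt_0_compat; apply Cmod_gt_0; apply Cminus_eq_contra; auto. }
  destruct (Pow_x_infinity q ltac:(rewrite Rabs_pos_eq; lra) (M0 / m + 1)) as [N HNq].
  specialize (HNq N (Nat.le_refl N)).
  rewrite Rabs_pos_eq in HNq by (apply pow_le; lra).
  specialize (HN N). fold m in HN.
  assert (Hp : 0 < (1 + eps) ^ N) by (apply pow_lt; lra).
  assert (Hqm : q ^ N * m <= M0).
  { unfold q, Rdiv. rewrite Rpow_mult_distr, pow_inv.
    apply Rmult_le_reg_l with ((1 + eps) ^ N); auto.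
    replace ((1 + eps) ^ N * (Cmod (F z) ^ N * / (1 + eps) ^ N * m))
      with (Cmod (F z) ^ N * m) by (field; lra). auto. }
  assert ((M0 / m + 1) * m <= q ^ N * m) by (apply Rmult_le_compat_r; lra).
  assert ((M0 / m + 1) * m = M0 + m) by (field; lra). lra.
Qed.

Lemma bernoulli (d : R) (n : nat) : 0 <= d <= 1 -> 1 - INR n * d <= (1 - d) ^ n.
Proof.
  intros Hd. induction n as [|n IH]; [simpl; lra|].
  rewrite S_INR. simpl. assert (0 <= INR n) by apply pos_INR.
  assert (0 <= (1 - d) ^ n) by (apply pow_le; lra).
  assert ((1 - INR n * d) * (1 - d) <= (1 - d) ^ n * (1 - d)) by (apply Rmult_le_compat_r; lra).
  nra.
Qed.

(** Near the unit circle, dividing by z^n costs at most a factor 1 + eps. With n d <= eps/(1 + eps),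
    Bernoulli gives (1 - d)^n >= 1/(1 + eps). *)
Lemma inv_pow_near_1 (n : nat) (eps : R) : 0 < eps ->
  exists r, 0 < r < 1 /\ forall t, r <= t -> / t ^ n <= 1 + eps.
Proof.
  intros He. set (d := eps / (1 + eps) / (INR n + 1)).
  assert (Hn : 0 <= INR n) by apply pos_INR.
  assert (H1 : 0 < eps / (1 + eps) < 1).
  { split; [apply Rdiv_lt_0_compat; lra|]. apply Rlt_div_l; lra. }
  assert (Hd : 0 < d) by (apply Rdiv_lt_0_compat; lra).
  assert (Hdn : d * (INR n + 1) = eps / (1 + eps)) by (unfold d; field; lra).
  assert (Hd1 : d < 1) by nra.
  exists (1 - d). split; [lra|]. intros t Ht.
  assert (B := bernoulli d n ltac:(lra)).
  assert (P := pow_incr (1 - d) t n ltac:(lra)).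
  assert (Hi : / (1 + eps) <= t ^ n).
  { replace (/ (1 + eps)) with (1 - eps / (1 + eps)) by (field; lra). nra. }
  rewrite <- (Rinv_inv (1 + eps)). apply Rinv_le_contravar; auto. apply Rinv_0_lt_compat; lra.
Qed.

(** The order condition bounds om/z^n near 0, and near the unit circle its modulus is almost at most
    1. Every hypothesis avoids z = 0, because z g'/g has no meaningful value there. Both punctures
    of the maximum principle are placed at 0. *)
Lemma schwarz_order (om : C -> C) (n : nat) :
  (forall z, Cmod z < 1 -> z <> 0%C -> exists b, ana om z b) ->
  (forall z, Cmod z < 1 -> z <> 0%C -> Cmod (om z) <= 1) ->
  (exists K d, 0 <= K /\ 0 < d /\ forall z, Cmod z < d -> z <> 0%C -> Cmod (om z) <= K * Cmod z ^ n) ->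
  forall z, Cmod z < 1 -> z <> 0%C -> Cmod (om z / z ^ n)%C <= 1.
Proof.
  intros Ha Hb (K & d & HK & Hd & HO) z Hz Hz0.
  assert (Hmod : forall w : C, w <> 0%C -> Cmod (om w / w ^ n)%C = Cmod (om w) / Cmod w ^ n).
  { intros w Hw. rewrite Cmod_div by (apply Cpow_nz; auto). now rewrite Cmod_pow. }
  assert (HN : bounded_near (fun w => (om w / w ^ n)%C) 0 0 0).
  { exists K, d. split; [auto|]. split; [auto|]. intros w Hw Hw0 _ Hwd.
    replace (w - 0)%C with w in Hwd by ring. rewrite Hmod by auto.
    assert (0 < Cmod w ^ n) by (apply pow_lt, Cmod_gt_0; auto).
    apply Rle_div_l; auto. }
  apply (punctured_max_principle (fun w => (om w / w ^ n)%C) 0 0); auto.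
  - intros w Hw Hw0 _. destruct (Ha w Hw Hw0) as [b Hb']. eexists.
    apply ana_div; [exact Hb' | apply ana_pow, ana_id | apply Cpow_nz; auto].
  - intros eps He. destruct (inv_pow_near_1 n eps He) as (r & Hr & H).
    exists r. split; [lra|]. intros w Hw Hw0 _. rewrite Hmod by auto.
    assert (0 < Cmod w ^ n) by (apply pow_lt, Cmod_gt_0; auto).
    specialize (H (Cmod w) ltac:(lra)). specialize (Hb w ltac:(lra) Hw0).
    assert (Q := Cmod_ge_0 (om w)).
    unfold Rdiv. assert (0 < / Cmod w ^ n) by (apply Rinv_0_lt_compat; auto). nra.
Qed.

(** Used in two ways: for values of the function, where the last product is nonnegative and gives a
    bound by 1, and for points z, where it tends to 0 at the unit circle. *)
Lemma blaschke_identity (p q : C) :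
  Cmod (1 - Cconj q * p)%C ^ 2 = Cmod (p - q) ^ 2 + (1 - Cmod p ^ 2) * (1 - Cmod q ^ 2).
Proof.
  rewrite !Cmod2_alt. destruct p, q.
  unfold Cconj, Cminus, Cplus, Copp, Cmult, RtoC, Re, Im; simpl. ring.
Qed.

Lemma blaschke_le (p q : C) : Cmod p <= 1 -> Cmod q <= 1 ->
  Cmod (p - q) <= Cmod (1 - Cconj q * p)%C.
Proof.
  intros Hp Hq. assert (H := blaschke_identity p q).
  assert (A1 := Cmod_ge_0 p). assert (A2 := Cmod_ge_0 q).
  assert (A3 := Cmod_ge_0 (p - q)). assert (A4 := Cmod_ge_0 (1 - Cconj q * p)%C).
  assert (0 <= (1 - Cmod p ^ 2) * (1 - Cmod q ^ 2)) by (apply Rmult_le_pos; nra).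
  apply Rnot_lt_le; intros Hl. nra.
Qed.

(** The form in which limits t -> 0 are taken in the Schwarz-Pick lemma. *)
Lemma le_of_linear_error (x y K d : R) : 0 < d ->
  (forall t, 0 < t < d -> x <= y + K * t) -> x <= y.
Proof.
  intros Hd H. apply Rnot_lt_le; intros Hl.
  set (t := Rmin (d / 2) ((x - y) / 2 / (Rabs K + 1))).
  assert (HK := Rabs_pos K). assert (HK' := Rle_abs K).
  assert (H0 : 0 < (x - y) / 2 / (Rabs K + 1)) by (apply Rdiv_lt_0_compat; lra).
  assert (Ht : 0 < t) by (apply Rmin_glb_lt; lra).
  assert (Ht1 : t <= d / 2) by apply Rmin_l.
  assert (Ht2 : t <= (x - y) / 2 / (Rabs K + 1)) by apply Rmin_r.
  specialize (H t ltac:(lra)).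
  assert ((x - y) / 2 = (Rabs K + 1) * ((x - y) / 2 / (Rabs K + 1))) by (field; lra).
  nra.
Qed.

(** The Blaschke factor of f at p0 = f z0, divided by that of the variable at z0, is bounded by 1 by
    the maximum principle with punctures 0 and z0; at z0 + t with t -> 0 this becomes the claim. The
    strict bound s < 1 keeps the denominator D away from 0. *)
Lemma schwarz_pick_strict (f : C -> C) (s : R) (z0 b : C) : s < 1 ->
  (forall z, Cmod z < 1 -> z <> 0%C -> exists c, ana f z c) ->
  (forall z, Cmod z < 1 -> z <> 0%C -> Cmod (f z) <= s) ->
  Cmod z0 < 1 -> z0 <> 0%C -> ana f z0 b ->
  Cmod b * (1 - Cmod z0 ^ 2) <= 1 - Cmod (f z0) ^ 2.
Proof.
  intros Hs Ha Hb Hz0 Hz0n Hb0.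
  set (r := Cmod z0) in *. assert (Hr : 0 < r) by (apply Cmod_gt_0; auto).
  set (p0 := f z0) in *.
  assert (Hp0 : Cmod p0 <= s) by (apply Hb; auto).
  assert (Hp00 := Cmod_ge_0 p0).
  set (D := fun w => (1 - Cconj p0 * f w)%C).
  set (E := fun w => (1 - Cconj z0 * w)%C).
  assert (HD : forall w, Cmod w < 1 -> w <> 0%C -> 1 - s ^ 2 <= Cmod (D w)).
  { intros w Hw Hw0. unfold D. assert (Q := Cmod_sub_le 1 (Cconj p0 * f w)%C).
    rewrite Cmod_1, Cmod_mult, Cmod_conj in Q. specialize (Hb w Hw Hw0).
    assert (Q2 := Cmod_ge_0 (f w)). nra. }
  assert (Hs2 : 0 < 1 - s ^ 2) by nra.
  assert (HDn : forall w, Cmod w < 1 -> w <> 0%C -> D w <> 0%C).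
  { intros w Hw Hw0 Q. specialize (HD w Hw Hw0). rewrite Q, Cmod_0 in HD. lra. }
  assert (HE : forall w, Cmod w < 1 -> Cmod (E w) <= 2).
  { intros w Hw. unfold E. eapply Rle_trans; [apply Cmod_minus_le|].
    rewrite Cmod_1, Cmod_mult, Cmod_conj. fold r. assert (Q := Cmod_ge_0 w). nra. }
  set (F := fun w => (((f w - p0) / D w) * (E w / (w - z0)))%C).
  assert (HFm : forall w, Cmod w < 1 -> w <> 0%C -> w <> z0 ->
     Cmod (F w) = Cmod (f w - p0) / Cmod (D w) * (Cmod (E w) / Cmod (w - z0))).
  { intros w Hw Hw0 Hwz. unfold F. rewrite Cmod_mult, !Cmod_div; auto.
    apply Cminus_eq_contra; auto. }
  assert (HB1 : forall w, Cmod w < 1 -> w <> 0%C -> Cmod (f w - p0) / Cmod (D w) <= 1).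
  { intros w Hw Hw0. specialize (HD w Hw Hw0). apply Rle_div_l; [lra|].
    rewrite Rmult_1_l. apply blaschke_le; [|lra]. specialize (Hb w Hw Hw0). lra. }
  assert (HB0 : forall w, Cmod w < 1 -> w <> 0%C -> 0 <= Cmod (f w - p0) / Cmod (D w)).
  { intros w Hw Hw0. specialize (HD w Hw Hw0). apply Rle_div_r; [lra|].
    rewrite Rmult_0_l. apply Cmod_ge_0. }
  assert (HF : forall w, Cmod w < 1 -> w <> 0%C -> w <> z0 -> Cmod (F w) <= 1).
  { apply punctured_max_principle.
    - intros w Hw Hw0 Hwz. destruct (Ha w Hw Hw0) as [c Hc]. eexists. unfold F.
      apply ana_mult; apply ana_div.
      + apply ana_minus; [exact Hc | apply ana_const].
      + unfold D. apply ana_minus; [apply ana_const|]. apply ana_mult; [apply ana_const | exact Hc].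
      + auto.
      + unfold E. apply ana_minus; [apply ana_const|]. apply ana_mult; [apply ana_const | apply ana_id].
      + apply ana_minus; [apply ana_id | apply ana_const].
      + apply Cminus_eq_contra; auto.
    (* Near 0 the point z0 is at distance at least r/2, so the second factor is bounded. *)
    - exists (2 / (r / 2)), (r / 2). split; [apply Rlt_le, Rdiv_lt_0_compat; lra|]. split; [lra|].
      intros w Hw Hw0 Hwz Hwd. replace (w - 0)%C with w in Hwd by ring.
      rewrite HFm by auto.
      assert (Q := Cmod_sub_le z0 w). rewrite Cmod_minus_sym in Q. fold r in Q.
      assert (Q2 : Cmod (E w) / Cmod (w - z0) <= 2 / (r / 2)).
      { unfold Rdiv at 1 2. apply Rmult_le_compat; auto using Cmod_ge_0.
        - apply Rlt_le, Rinv_0_lt_compat; lra.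
        - apply Rinv_le_contravar; lra. }
      assert (Q3 : 0 <= Cmod (E w) / Cmod (w - z0)).
      { apply Rle_div_r; [lra|]. rewrite Rmult_0_l; apply Cmod_ge_0. }
      specialize (HB1 w Hw Hw0). specialize (HB0 w Hw Hw0). nra.
    (* Near z0 the Lipschitz bound on f cancels the pole 1/(w - z0). *)
    - destruct Hb0 as [c Hc]. destruct (jet_lip _ _ _ _ Hc) as (K & d & HK & Hd & HL).
      exists (K * 2 / (1 - s ^ 2)), d.
      split. { apply Rmult_le_pos; [lra|]. apply Rlt_le, Rinv_0_lt_compat; lra. }
      split; auto. intros w Hw Hw0 Hwz Hwd. rewrite HFm by auto.
      specialize (HL _ Hwd). replace (z0 + (w - z0))%C with w in HL by ring. fold p0 in HL.
      specialize (HD w Hw Hw0). specialize (HE w Hw).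
      assert (Hwp : 0 < Cmod (w - z0)) by (apply Cmod_gt_0, Cminus_eq_contra; auto).
      replace (Cmod (f w - p0) / Cmod (D w) * (Cmod (E w) / Cmod (w - z0)))
        with ((Cmod (f w - p0) / Cmod (w - z0)) * Cmod (E w) * / Cmod (D w)) by (field; lra).
      assert (Q1 : Cmod (f w - p0) / Cmod (w - z0) <= K) by (apply Rle_div_l; auto).
      assert (Q0 : 0 <= Cmod (f w - p0) / Cmod (w - z0)).
      { apply Rle_div_r; [lra|]. rewrite Rmult_0_l; apply Cmod_ge_0. }
      assert (QE := Cmod_ge_0 (E w)).
      unfold Rdiv at 2. apply Rmult_le_compat.
      + apply Rmult_le_pos; auto.
      + apply Rlt_le, Rinv_0_lt_compat; lra.
      + apply Rmult_le_compat; auto.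
      + apply Rinv_le_contravar; lra.
    (* Near the circle |w - z0| >= m, and 1 - |w|^2 <= eps m^2, so the Blaschke identity gives |E
       w|^2 <= (1 + eps) |w - z0|^2. *)
    - intros eps He. set (m := (1 - r) / 2).
      assert (Hm : 0 < m) by (unfold m; lra).
      exists (Rmax (1 - m) (1 - eps * m ^ 2 / 2)).
      split. { apply Rmax_lub_lt; [lra|]. assert (0 < eps * m ^ 2) by (apply Rmult_lt_0_compat; nra). lra. }
      intros w [Hw1 Hw] Hw0 Hwz. rewrite HFm by auto.
      assert (L1 := Rmax_l (1 - m) (1 - eps * m ^ 2 / 2)).
      assert (L2 := Rmax_r (1 - m) (1 - eps * m ^ 2 / 2)).
      assert (Q := Cmod_sub_le w z0). fold r in Q.
      assert (Hwm : m <= Cmod (w - z0)) by (unfold m in *; lra).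
      assert (HEle : Cmod (E w) <= (1 + eps) * Cmod (w - z0)).
      { assert (I := blaschke_identity w z0). fold (E w) r in I.
        assert (A := Cmod_ge_0 (E w)). assert (A2 := Cmod_ge_0 w).
        assert (X : (1 - Cmod w ^ 2) * (1 - r ^ 2) <= eps * m ^ 2).
        { assert (1 - Cmod w ^ 2 <= eps * m ^ 2) by nra.
          assert (0 <= 1 - Cmod w ^ 2) by nra. assert (1 - r ^ 2 <= 1) by nra. assert (0 <= 1 - r ^ 2) by nra.
          nra. }
        assert (m ^ 2 <= Cmod (w - z0) ^ 2) by (apply pow_incr; lra).
        assert (Cmod (E w) ^ 2 <= ((1 + eps) * Cmod (w - z0)) ^ 2).
        { rewrite I. nra. }
        apply Rnot_lt_le; intros Hl. assert (0 <= (1 + eps) * Cmod (w - z0)) by nra. nra. }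
      assert (Q2 : Cmod (E w) / Cmod (w - z0) <= 1 + eps) by (apply Rle_div_l; lra).
      assert (Q3 : 0 <= Cmod (E w) / Cmod (w - z0)).
      { apply Rle_div_r; [lra|]. rewrite Rmult_0_l; apply Cmod_ge_0. }
      specialize (HB1 w Hw Hw0). specialize (HB0 w Hw Hw0). nra. }
  destruct Hb0 as [c (K & d & HK & Hd & HJ)].
  destruct (jet_lip f z0 b c) as (K' & d' & HK' & Hd' & HL).
  { exists K, d. auto. }
  fold p0 in HJ, HL.
  apply (le_of_linear_error _ _ (K' + Cmod b + (Cmod c + K)) (Rmin (Rmin d d') (Rmin (1 - r) (r / 2)))).
  { repeat apply Rmin_glb_lt; lra. }
  intros t [Ht Htm].
  assert (T1 : t < Rmin d d') by (eapply Rlt_le_trans; [apply Htm | apply Rmin_l]).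
  assert (T2 : t < Rmin (1 - r) (r / 2)) by (eapply Rlt_le_trans; [apply Htm | apply Rmin_r]).
  assert (t1 : t < d) by (eapply Rlt_le_trans; [apply T1 | apply Rmin_l]).
  assert (t2 : t < d') by (eapply Rlt_le_trans; [apply T1 | apply Rmin_r]).
  assert (t3 : t < 1 - r) by (eapply Rlt_le_trans; [apply T2 | apply Rmin_l]).
  assert (t4 : t < r / 2) by (eapply Rlt_le_trans; [apply T2 | apply Rmin_r]).
  assert (Hht : Cmod (RtoC t) = t) by (rewrite Cmod_R, Rabs_pos_eq; lra).
  set (h := RtoC t) in *. set (w := (z0 + h)%C).
  assert (Hwh : (w - z0)%C = h) by (unfold w; ring).
  assert (Hw1 : Cmod w < 1).
  { unfold w. eapply Rle_lt_trans; [apply Cmod_triangle|]. fold r. lra. }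
  assert (Hw0 : w <> 0%C).
  { intros Q. assert (X := Cmod_sub_le z0 (-h)%C). replace (z0 - - h)%C with w in X by (unfold w; ring).
    rewrite Q, Cmod_0, Cmod_opp in X. fold r in X. lra. }
  assert (Hwz : w <> z0).
  { intros Q. rewrite Q in Hwh. replace (z0 - z0)%C with (RtoC 0) in Hwh by ring.
    rewrite <- Hwh, Cmod_0 in Hht. lra. }
  assert (G := HF w Hw1 Hw0 Hwz). rewrite HFm in G by auto. rewrite Hwh, Hht in G.
  assert (HDw := HD w Hw1 Hw0).
  assert (G2 : Cmod (f w - p0) * Cmod (E w) <= t * Cmod (D w)).
  { replace (Cmod (f w - p0) * Cmod (E w))
      with (Cmod (f w - p0) / Cmod (D w) * (Cmod (E w) / t) * (t * Cmod (D w))) by (field; lra).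
    rewrite <- (Rmult_1_l (t * Cmod (D w))) at 2. apply Rmult_le_compat_r; nra. }
  specialize (HJ h ltac:(lra)). specialize (HL h ltac:(lra)). rewrite Hht in HJ, HL.
  fold w in HJ, HL.
  (* All three factors of [G2] are compared with their values at t = 0, up to errors linear in t. *)
  assert (cp := Cmod_ge_0 c). assert (bp := Cmod_ge_0 b).
  assert (X1 : t * (Cmod b - (Cmod c + K) * t) <= Cmod (f w - p0)).
  { assert (X := Cmod_sub_le (b * h)%C (- (c * h ^ 2 + (f w - (p0 + b * h + c * h ^ 2))))%C).
    replace (b * h - - (c * h ^ 2 + (f w - (p0 + b * h + c * h ^ 2))))%C with (f w - p0)%C in X by ring.
    rewrite Cmod_opp, Cmod_mult, Hht in X.
    assert (Y := Cmod_triangle (c * h ^ 2)%C (f w - (p0 + b * h + c * h ^ 2))%C).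
    rewrite Cmod_mult, Cmod_pow, Hht in Y.
    assert (K * t ^ 3 <= K * t ^ 2) by (apply Rmult_le_compat_l; simpl; nra). simpl in *. lra. }
  assert (X2 : 1 - r ^ 2 - t <= Cmod (E w)).
  { assert (X := Cmod_sub_le (1 - Cconj z0 * z0)%C (Cconj z0 * h)%C).
    replace (1 - Cconj z0 * z0 - Cconj z0 * h)%C with (E w) in X by (unfold E, w; ring).
    rewrite Cmod_mult, Cmod_conj, Hht in X. fold r in X.
    replace (1 - Cconj z0 * z0)%C with (RtoC (1 - r ^ 2)) in X.
    - rewrite Cmod_R in X. assert (Y := Rle_abs (1 - r ^ 2)). nra.
    - rewrite RtoC_minus. unfold r. rewrite Cmod2_conj. ring. }
  assert (X3 : Cmod (D w) <= 1 - Cmod p0 ^ 2 + K' * t).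
  { assert (X := Cmod_minus_le (1 - Cconj p0 * p0)%C (Cconj p0 * (f w - p0))%C).
    replace (1 - Cconj p0 * p0 - Cconj p0 * (f w - p0))%C with (D w) in X by (unfold D; ring).
    rewrite Cmod_mult, Cmod_conj in X.
    replace (1 - Cconj p0 * p0)%C with (RtoC (1 - Cmod p0 ^ 2)) in X.
    - rewrite Cmod_R, Rabs_pos_eq in X by nra.
      assert (Y := Cmod_ge_0 (f w - p0)). nra.
    - rewrite RtoC_minus, Cmod2_conj. ring. }
  assert (HE0 := Cmod_ge_0 (E w)). assert (Hf0 := Cmod_ge_0 (f w - p0)).
  assert (HcK : 0 <= Cmod c + K) by lra.
  (* If the lower bound for the difference quotient is not positive, then |b| is itself of order
     t. *)
  destruct (Rle_lt_dec (Cmod b - (Cmod c + K) * t) 0) as [Hneg|Hpos].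
  - assert (0 <= 1 - r ^ 2 <= 1) by nra.
    assert (Cmod b * (1 - r ^ 2) <= Cmod b) by nra.
    assert (0 <= 1 - Cmod p0 ^ 2) by nra. nra.
  - assert (X4 : t * ((Cmod b - (Cmod c + K) * t) * (1 - r ^ 2 - t)) <= t * Cmod (D w)).
    { eapply Rle_trans; [|exact G2].
      apply Rle_trans with (t * (Cmod b - (Cmod c + K) * t) * Cmod (E w)).
      - rewrite Rmult_assoc. apply Rmult_le_compat_l; [lra|]. apply Rmult_le_compat_l; lra.
      - apply Rmult_le_compat_r; auto. }
    apply Rmult_le_reg_l in X4; auto.
    assert (0 <= 1 - r ^ 2 <= 1) by nra.
    assert (0 <= (Cmod c + K) * t) by nra.
    nra.
Qed.

(** The strict version applies to (1 - t) f with s = 1 - t, and t tends to 0. *)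
Lemma schwarz_pick (f : C -> C) (z0 b : C) :
  (forall z, Cmod z < 1 -> z <> 0%C -> exists c, ana f z c) ->
  (forall z, Cmod z < 1 -> z <> 0%C -> Cmod (f z) <= 1) ->
  Cmod z0 < 1 -> z0 <> 0%C -> ana f z0 b ->
  Cmod b * (1 - Cmod z0 ^ 2) <= 1 - Cmod (f z0) ^ 2.
Proof.
  intros Ha Hb Hz0 Hz0n Hb0.
  apply (le_of_linear_error _ _ (Cmod b * 1 + 2) 1 ltac:(lra)).
  intros t Ht.
  assert (Hm : forall w : C, Cmod (RtoC (1 - t) * w)%C = (1 - t) * Cmod w).
  { intros w. rewrite Cmod_mult, Cmod_R, Rabs_pos_eq; lra. }
  assert (H := schwarz_pick_strict (fun w => (RtoC (1 - t) * f w)%C) (1 - t) z0 (RtoC (1 - t) * b)%C).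
  simpl in H. rewrite !Hm in H.
  assert (P1 := Cmod_ge_0 b). assert (P2 := Cmod_ge_0 z0). assert (P3 := Cmod_ge_0 (f z0)).
  assert (P4 := Hb z0 Hz0 Hz0n).
  assert (H' : (1 - t) * Cmod b * (1 - Cmod z0 * (Cmod z0 * 1)) <= 1 - (1 - t) * Cmod (f z0) * ((1 - t) * Cmod (f z0) * 1)).
  { apply H; auto; [lra| | |].
    - intros z Hz Hzn. destruct (Ha z Hz Hzn) as [c Hc]. eexists. apply ana_mult; [apply ana_const | exact Hc].
    - intros z Hz Hzn. rewrite Hm. specialize (Hb z Hz Hzn). nra.
    - eapply ana_ext; [| |exact (ana_mult _ _ _ _ _ (ana_const (RtoC (1 - t)) z0) Hb0)]; simpl; intros; ring. }
  assert (0 <= Cmod b * (1 - Cmod z0 ^ 2) <= Cmod b).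
  { assert (0 <= 1 - Cmod z0 ^ 2 <= 1) by nra. nra. }
  assert (0 <= Cmod (f z0) ^ 2 <= 1) by nra.
  nra.
Qed.

(** * MacGregor's bound for z p'/p *)

(** Divided by 1 - r^2, this says that twice r + r^3 + ... + r^(2n-1) is at most n (1 + r^(2n));
    pairing exponents a + b = 2n in r^a + r^b <= 1 + r^(a+b) explains it. The proof is by
    induction. *)
Lemma odd_even_power_mean (r : R) (n : nat) : 0 <= r < 1 ->
  2 * r * (1 - r ^ (2 * n)) <= INR n * (1 + r ^ (2 * n)) * (1 - r ^ 2).
Proof.
  intros Hr. 
  (* The even companion n r^(2n) <= 1 + r^2 + ... + r^(2n-2), which controls the increment in the
     induction. *)
  assert (B : forall n, 0 <= r ^ (2 * n) <= 1 /\ INR n * (1 - r ^ 2) * r ^ (2 * n) <= 1 - r ^ (2 * n)).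
  { clear n. intros n. induction n as [|n [IH1 IH]]; [simpl; lra|].
    replace (2 * S n)%nat with (2 + 2 * n)%nat by lia. rewrite pow_add, S_INR.
    set (q := r ^ (2 * n)) in *. assert (0 <= r ^ 2 <= 1) by nra.
    assert (0 <= INR n) by apply pos_INR.
    split; [nra|].
    assert (INR n * (1 - r ^ 2) * q * r ^ 2 <= (1 - q) * r ^ 2) by (apply Rmult_le_compat_r; lra).
    assert (Q : 0 <= r ^ 2 * q <= 1) by nra.
    assert (Q2 := Rmult_le_compat_l (1 - r ^ 2) _ _ ltac:(lra) (proj2 Q)). lra. }
  induction n as [|n IH]; [simpl; lra|].
  destruct (B n) as [B1 B2].
  replace (2 * S n)%nat with (2 + 2 * n)%nat by lia. rewrite pow_add, S_INR.
  set (q := r ^ (2 * n)) in *. assert (0 <= INR n) by apply pos_INR.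
  assert (Key : 0 <= (1 - r ^ 2) * (1 - q + q * ((1 - r) ^ 2 - INR n * (1 - r ^ 2)))).
  { apply Rmult_le_pos; [nra|]. assert (0 <= q * (1 - r) ^ 2) by (apply Rmult_le_pos; [lra|apply pow2_ge_0]). lra. }
  assert (2 * r * (1 - r ^ 2 * q) = 2 * r * (1 - q) + 2 * r * q * (1 - r ^ 2)) by ring.
  assert ((INR n + 1) * (1 + r ^ 2 * q) * (1 - r ^ 2) = INR n * (1 + q) * (1 - r ^ 2) +
     (1 - r ^ 2) * (1 - q + q * ((1 - r) ^ 2 - INR n * (1 - r ^ 2))) + 2 * r * q * (1 - r ^ 2)) by ring.
  lra.
Qed.

(* MacGregor's bound. With [(p - 1)/(p + 1) = z^n psi] one has
   [z p'/p = 2 z^n (z psi' + n psi) / (1 - (z^n psi)^2)], and Schwarz-Pick bounds [psi']. *)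
Lemma caratheodory_log_deriv (p : C -> C) (n : nat) (z0 b : C) : (1 <= n)%nat ->
  (forall z, Cmod z < 1 -> exists c, ana p z c) ->
  (forall z, Cmod z < 1 -> 0 < fst (p z)) ->
  (exists K d, 0 <= K /\ 0 < d /\ forall z, Cmod z < d -> Cmod (p z - 1) <= K * Cmod z ^ n) ->
  Cmod z0 < 1 -> z0 <> 0%C -> ana p z0 b ->
  Cmod (z0 * b / p z0)%C * (1 - (Cmod z0 ^ n) ^ 2) <= 2 * INR n * Cmod z0 ^ n.
Proof.
  intros Hn Ha Hre (K & d & HK & Hd & HO) Hz0 Hz0n Hb0.
  assert (Hp1 : forall z, Cmod z < 1 -> 1 <= Cmod (p z + 1)%C).
  { intros z Hz. assert (Q := fst_le_Cmod (p z + 1)%C). specialize (Hre z Hz). simpl in Q.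
    rewrite Rabs_pos_eq in Q by lra. lra. }
  assert (Hp1n : forall z, Cmod z < 1 -> (p z + 1)%C <> 0%C).
  { intros z Hz Q. specialize (Hp1 z Hz). rewrite Q, Cmod_0 in Hp1. lra. }
  assert (Hpn : forall z, Cmod z < 1 -> p z <> 0%C).
  { intros z Hz Q. specialize (Hre z Hz). rewrite Q in Hre. simpl in Hre. lra. }
  set (om := fun z => ((p z - 1) / (p z + 1))%C).
  assert (Hom : forall z, Cmod z < 1 -> exists c, ana om z c).
  { intros z Hz. destruct (Ha z Hz) as [c Hc]. eexists. unfold om.
    apply ana_div; [apply ana_minus | apply ana_plus | auto]; try exact Hc; apply ana_const. }
  assert (Homb : forall z, Cmod z < 1 -> Cmod (om z) <= 1).
  { intros z Hz. unfold om. rewrite Cmod_div by auto. specialize (Hp1 z Hz).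
    apply Rle_div_l; [lra|]. rewrite Rmult_1_l.
    specialize (Hre z Hz). unfold Cmod. apply sqrt_le_1_alt. destruct (p z); simpl in *. nra. }
  set (ps := fun z => (om z / z ^ n)%C).
  assert (Hps1 : forall z, Cmod z < 1 -> z <> 0%C -> Cmod (ps z) <= 1).
  { apply schwarz_order; auto.
    exists K, (Rmin d 1). split; [auto|]. split; [apply Rmin_glb_lt; lra|].
    intros z Hz Hzn.
    assert (h1 : Cmod z < d) by (eapply Rlt_le_trans; [apply Hz | apply Rmin_l]).
    assert (h2 : Cmod z < 1) by (eapply Rlt_le_trans; [apply Hz | apply Rmin_r]).
    unfold om. rewrite Cmod_div by auto. specialize (Hp1 z h2). specialize (HO z h1).
    assert (Q : 0 <= K * Cmod z ^ n) by (apply Rmult_le_pos; [auto|apply pow_le, Cmod_ge_0]).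
    apply Rle_div_l; nra. }
  assert (Hpsa : forall z c, Cmod z < 1 -> z <> 0%C -> ana p z c ->
     exists c', ana ps z c' /\ 
       ((z * c / p z) * (1 - (z ^ n * ps z) ^ 2) = 2 * (z ^ n * (z * c' + RtoC (INR n) * ps z)))%C).
  { intros z c Hz Hzn Hc. eexists. split.
    - unfold ps, om. apply ana_div; [apply ana_div; [apply ana_minus | apply ana_plus | auto] | apply ana_pow, ana_id | apply Cpow_nz; auto];
      try exact Hc; apply ana_const.
    - unfold ps, om. destruct n as [|m]; [lia|]. simpl pred. rewrite !Cpow_S.
      assert (A1 := Hp1n z Hz). assert (A2 := Hpn z Hz). assert (A3 : (z ^ m)%C <> 0%C) by (apply Cpow_nz; auto).
      field. repeat split; auto. }
  destruct (Hpsa z0 b Hz0 Hz0n Hb0) as (c & Hc & Heq).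
  assert (SP : Cmod c * (1 - Cmod z0 ^ 2) <= 1 - Cmod (ps z0) ^ 2).
  { apply schwarz_pick; auto. intros z Hz Hzn. destruct (Ha z Hz) as [c' Hc'].
    destruct (Hpsa z c' Hz Hzn Hc') as (c'' & H & _). eauto. }
  set (T := (z0 * b / p z0)%C) in *. set (r := Cmod z0) in *. set (x := r ^ n).
  set (t := Cmod (ps z0)) in *.
  assert (Hr : 0 < r) by (apply Cmod_gt_0; auto).
  assert (Hx : 0 < x) by (apply pow_lt; auto).
  assert (Hx1 : x < 1) by (apply pow_lt_1_compat; [lra|lia]).
  assert (Ht0 : 0 <= t) by apply Cmod_ge_0. assert (Ht1 : t <= 1) by (apply Hps1; auto).
  assert (N0 : 1 <= INR n) by (replace 1 with (INR 1) by auto; apply le_INR; auto).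
  assert (E1 : Cmod T * (1 - x ^ 2 * t ^ 2) <= 2 * (x * (r * Cmod c + INR n * t))).
  { apply (f_equal Cmod) in Heq. rewrite !Cmod_mult, Cmod_R, Cmod_pow, Rabs_pos_eq in Heq by lra.
    fold r x in Heq.
    assert (Y1 := Cmod_triangle (z0 * c)%C (RtoC (INR n) * ps z0)%C).
    rewrite !Cmod_mult, Cmod_R, Rabs_pos_eq in Y1 by lra. fold r t in Y1.
    assert (Y2 := Cmod_sub_le 1 ((z0 ^ n * ps z0) ^ 2)%C).
    rewrite Cmod_1, Cmod_pow, Cmod_mult, Cmod_pow in Y2. fold r x t in Y2.
    replace ((x * t) ^ 2) with (x ^ 2 * t ^ 2) in Y2 by ring.
    assert (YT := Cmod_ge_0 T).
    apply Rle_trans with (Cmod T * Cmod (1 - (z0 ^ n * ps z0) ^ 2)%C).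
    - apply Rmult_le_compat_l; auto.
    - rewrite Heq. apply Rmult_le_compat_l; [lra|]. apply Rmult_le_compat_l; lra. }
  assert (Key : 2 * r * (1 - x ^ 2) <= INR n * (1 + x ^ 2) * (1 - r ^ 2)).
  { unfold x. rewrite <- pow_mult, Nat.mul_comm. apply odd_even_power_mean; lra. }
  assert (Hr2 : 0 < 1 - r ^ 2) by nra. assert (Hx2 : 0 < x ^ 2 < 1) by nra.
  (* Both sides are affine in t, so it suffices to combine t = 1, which is [Key], with t = 0, which
     is [Q]. *)
  assert (Key2 : r * (1 + t) * (1 - x ^ 2) <= INR n * (1 + x ^ 2 * t) * (1 - r ^ 2)).
  { assert (Q : r * (1 - x ^ 2) <= INR n * (1 - r ^ 2)).
    { assert (INR n * (1 + x ^ 2) * (1 - r ^ 2) <= INR n * 2 * (1 - r ^ 2)).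
      { apply Rmult_le_compat_r; [lra|]. apply Rmult_le_compat_l; lra. }
      lra. }
    assert (Q1 := Rmult_le_compat_l t _ _ Ht0 Key).
    assert (Q2 := Rmult_le_compat_l (1 - t) _ _ ltac:(lra) Q). lra. }
  set (y := x ^ 2) in *.
  assert (Hyt : 0 < 1 - y * t ^ 2).
  { assert (0 <= t ^ 2 <= 1) by nra. nra. }
  apply Rmult_le_reg_l with ((1 - r ^ 2) * (1 - y * t ^ 2)); [apply Rmult_lt_0_compat; auto|].
  (* The three estimates add up exactly to the goal because (1 - t)(1 + y t) + t (1 - y) = 1 - y
     t^2. *)
  assert (S1 := Rmult_le_compat_l ((1 - r ^ 2) * (1 - y)) _ _ ltac:(apply Rmult_le_pos; lra) E1).
  assert (S2 := Rmult_le_compat_l (2 * x * r * (1 - y)) _ _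
     ltac:(apply Rmult_le_pos; [|lra]; apply Rmult_le_pos; lra) SP).
  assert (S3 := Rmult_le_compat_l (2 * x * (1 - t)) _ _
     ltac:(apply Rmult_le_pos; [|lra]; lra) Key2).
  lra.
Qed.

(** * Inclusion in Omega_Ne *)

Lemma Cderiv_of_ana (f : C -> C) (z b : C) : ana f z b -> Cderiv f z b.
Proof.
  intros [c (K & d & HK & Hd & H)] eps He.
  assert (Hc := Cmod_ge_0 c).
  set (r := eps / (Cmod c + K + 1)).
  assert (Hr : 0 < r) by (apply Rdiv_lt_0_compat; lra).
  assert (Hre : eps = (Cmod c + K + 1) * r) by (unfold r; field; lra).
  exists (Rmin d (Rmin 1 r)). split; [repeat apply Rmin_glb_lt; lra|].
  (* The complex operations of the statement are convertible with those of the proof, so [change]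
     passes between them. *)
  intros h Hh Hn. change (h <> RtoC 0) in Hh. change (Cmod h < Rmin d (Rmin 1 r)) in Hn.
  change (Cmod ((f (z + h) - f z) / h - b)%C < eps).
  assert (h1 : Cmod h < d) by (eapply Rlt_le_trans; [apply Hn | apply Rmin_l]).
  assert (h0 : Cmod h < Rmin 1 r) by (eapply Rlt_le_trans; [apply Hn | apply Rmin_r]).
  assert (h2 : Cmod h < 1) by (eapply Rlt_le_trans; [apply h0 | apply Rmin_l]).
  assert (h3 : Cmod h < r) by (eapply Rlt_le_trans; [apply h0 | apply Rmin_r]).
  specialize (H h h1). assert (Hp : 0 < Cmod h) by (apply Cmod_gt_0; auto).
  set (E := (f (z + h) - (f z + b * h + c * h ^ 2))%C) in *.
  replace ((f (z + h) - f z) / h - b)%C with (c * h + E / h)%C by (unfold E; field; auto).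
  eapply Rle_lt_trans; [apply Cmod_triangle|]. rewrite Cmod_mult, Cmod_div by auto.
  assert (Cmod E / Cmod h <= K * Cmod h).
  { apply Rle_div_l; auto. eapply Rle_trans; [apply H|]. simpl.
    assert (0 <= K * (Cmod h * Cmod h)) by (apply Rmult_le_pos; nra). nra. }
  assert (Cmod c * Cmod h <= Cmod c * r) by (apply Rmult_le_compat_l; lra).
  nra.
Qed.

Lemma Cderiv_unique (f : C -> C) (z b b' : C) : Cderiv f z b -> Cderiv f z b' -> b = b'.
Proof.
  intros H H'. apply NNPP; intros Hne.
  assert (Hp : 0 < Cmod (b - b')) by (apply Cmod_gt_0, Cminus_eq_contra; auto).
  destruct (H (Cmod (b - b') / 2) ltac:(lra)) as (d & Hd & HD).
  destruct (H' (Cmod (b - b') / 2) ltac:(lra)) as (d' & Hd' & HD').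
  set (t := Rmin d d' / 2).
  assert (Hm : 0 < Rmin d d') by (apply Rmin_glb_lt; auto).
  assert (L1 := Rmin_l d d'). assert (L2 := Rmin_r d d').
  assert (Ht : Cmod (RtoC t) = t) by (rewrite Cmod_R, Rabs_pos_eq; unfold t; lra).
  assert (Hn : RtoC t <> RtoC 0) by (intros E; apply RtoC_inj in E; unfold t in E; lra).
  specialize (HD (RtoC t) Hn ltac:(change (Cmod (RtoC t) < d); rewrite Ht; unfold t; lra)).
  specialize (HD' (RtoC t) Hn ltac:(change (Cmod (RtoC t) < d'); rewrite Ht; unfold t; lra)).
  change (Cmod ((f (z + RtoC t) - f z) / RtoC t - b)%C < Cmod (b - b') / 2) in HD.
  change (Cmod ((f (z + RtoC t) - f z) / RtoC t - b')%C < Cmod (b - b') / 2) in HD'.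
  assert (T := Cmod_minus_le ((f (z + RtoC t) - f z) / RtoC t - b')%C ((f (z + RtoC t) - f z) / RtoC t - b)%C).
  replace ((f (z + RtoC t) - f z) / RtoC t - b' - ((f (z + RtoC t) - f z) / RtoC t - b))%C
    with (b - b')%C in T by ring.
  lra.
Qed.

(** Uniqueness of the derivative identifies the one quantified in [Qf_is] with the known value b. *)
Lemma Qf_is_iff (f : C -> C) (z b q : C) : ana f z b ->
  (Qf_is f z q <-> f z <> 0%C /\ q = (z * b / f z)%C).
Proof.
  intros Hb. apply Cderiv_of_ana in Hb. split.
  - intros [H (d & Hd & Hq)]. split; [exact H|]. rewrite (Cderiv_unique _ _ _ _ Hb Hd). exact Hq.
  - intros [H Hq]. split; [exact H|]. exists b. auto.
Qed.

Lemma Qf_product (f g p : C -> C) (z b c q : C) :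
  Cmod z < 1 -> (forall w, Cmod w < 1 -> f w = (g w * p w)%C) ->
  ana g z b -> ana p z c -> p z <> 0%C -> Qf_is g z q ->
  Qf_is f z (q + z * c / p z)%C.
Proof.
  intros Hz Hf Hb Hc Hp HQ. apply (Qf_is_iff _ _ _ _ Hb) in HQ. destruct HQ as [Hg ->].
  assert (Ha : ana f z (g z * c + b * p z)%C).
  { apply (ana_local_ext (fun w => g w * p w)%C) with (d0 := 1 - Cmod z); [lra| |apply ana_mult; auto].
    intros h Hh. symmetry; apply Hf. assert (T := Cmod_triangle z h). lra. }
  apply (Qf_is_iff _ _ _ _ Ha). rewrite (Hf z Hz). split.
  - apply Cmult_neq_0; auto.
  - field; auto.
Qed.

(* [1 + u - u^3/3 = w] is the fixed point equation of [u |-> (w - 1) + u^3/3], a contraction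
   of the disc of radius [1/3 + |w - 1|]; its fixed point is the minimizer of [|T u - u|]. *)
Lemma OmegaNe_disc (w : C) : Cmod (w - 1) < 2 / 3 -> OmegaNe w.
Proof.
  intros Hw. set (v := (w - 1)%C) in *. assert (Hv0 := Cmod_ge_0 v).
  (* Here s < 1, hence |v| + s^3/3 <= s and T preserves the disc; its contraction ratio there is
     s^2. *)
  set (s := 1 / 3 + Cmod v).
  set (T := fun u => (v + u ^ 3 / RtoC 3)%C).
  assert (H3 : RtoC 3 <> RtoC 0) by (intros E; apply RtoC_inj in E; lra).
  assert (M3 : forall u : C, Cmod (u / RtoC 3)%C = Cmod u / 3).
  { intros u. rewrite Cmod_div by auto. rewrite Cmod_R, Rabs_pos_eq; lra. }
  assert (HT : forall u, Cmod u <= s -> Cmod (T u) <= s).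
  { intros u Hu. unfold T. eapply Rle_trans; [apply Cmod_triangle|]. rewrite M3, Cmod_pow.
    assert (P := pow_incr (Cmod u) s 3 ltac:(split; [apply Cmod_ge_0|auto])).
    unfold s in *. set (y := Cmod v) in *. simpl in P. simpl. nra. }
  assert (HL : forall u u', Cmod u <= s -> Cmod u' <= s -> Cmod (T u - T u') <= s ^ 2 * Cmod (u - u')).
  { intros u u' Hu Hu'. unfold T.
    replace (v + u ^ 3 / RtoC 3 - (v + u' ^ 3 / RtoC 3))%C
      with ((u - u') * (u ^ 2 + u * u' + u' ^ 2) / RtoC 3)%C by (field; auto).
    rewrite M3, Cmod_mult.
    assert (Cmod (u ^ 2 + u * u' + u' ^ 2)%C <= 3 * s ^ 2).
    { eapply Rle_trans; [apply Cmod_triangle|]. eapply Rle_trans; [apply Rplus_le_compat_r, Cmod_triangle|].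
      rewrite Cmod_mult, !Cmod_pow. assert (A := Cmod_ge_0 u). assert (B := Cmod_ge_0 u'). nra. }
    assert (A := Cmod_ge_0 (u - u')). nra. }
  assert (HTa : forall u, exists c, ana (fun u => T u - u)%C u c).
  { intros u. eexists. unfold T. apply ana_minus; [|apply ana_id].
    apply ana_plus; [apply ana_const|]. apply ana_div; [apply ana_pow, ana_id | apply ana_const | auto]. }
  destruct (disc_max (fun u => - Cmod (T u - u)) s) as (u & Hu & Hmin).
  { unfold s; lra. }
  { intros u _ eps He. destruct (HTa u) as [c Hc].
    destruct (ana_continuous _ _ _ Hc eps He) as (d & Hd & HD).
    exists d. split; auto. intros u' _ Hu'. specialize (HD u' Hu'). simpl in HD.
    eapply Rle_lt_trans; [|exact HD].
    assert (A := Cmod_sub_le (T u' - u')%C (T u - u)%C).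
    assert (B := Cmod_sub_le (T u - u)%C (T u' - u')%C).
    rewrite (Cmod_minus_sym (T u - u)%C) in B. apply Rabs_le. lra. }
  (* Applying T to the minimizer would shrink |T u - u| by the factor s^2 < 1 unless it is already
     0. *)
  assert (Hfix : Cmod (T u - u) = 0).
  { specialize (Hmin (T u) (HT u Hu)). simpl in Hmin.
    assert (A := HL (T u) u (HT u Hu) Hu). assert (B := Cmod_ge_0 (T u - u)).
    assert (s ^ 2 < 1) by (unfold s; simpl; nra). nra. }
  exists u. split.
  - change (Cmod u < 1). unfold s in Hu. lra.
  - change (w = ((1 + u) - u ^ 3 / RtoC 3)%C). apply Cmod_eq_0 in Hfix.
    replace w with (1 + v)%C by (unfold v; ring).
    assert (E : v = (u - u ^ 3 / RtoC 3)%C).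
    { replace v with ((T u - u) + (u - u ^ 3 / RtoC 3))%C by (unfold T; ring). rewrite Hfix. ring. }
    rewrite E. ring.
Qed.

(** * Estimates for the factors g and p *)

Lemma cser_tail (a : nat -> C) (z s : C) :
  Cseries_cv a z s ->
  cser (fun k => (match k with O => RtoC 0 | _ => a k end) * z ^ k)%C (s - a 0%nat)%C.
Proof.
  intros H. apply cser_cv in H.
  replace s with (a 0%nat * z ^ 0 + (s - a 0%nat))%C in H by (simpl; ring).
  apply (cser_S (fun k => (a k * z ^ k)%C)) in H.
  replace (s - a 0%nat)%C with ((fun k => (match k with O => RtoC 0 | _ => a k end) * z ^ k)%C 0%nat + (s - a 0%nat))%C
    by (simpl; ring).
  apply (cser_S (fun k => (match k with O => RtoC 0 | _ => a k end) * z ^ k)%C). exact H.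
Qed.

(** The operator z d/dz multiplies the k-th coefficient by k without moving indices, so it can be
    compared with the original series. *)
Lemma cser_euler (a : nat -> C) (z s1 : C) :
  Cseries_cv (dcoef a) z s1 -> Cseries_cv (fun k => RtoC (INR k) * a k)%C z (z * s1)%C.
Proof.
  intros H. apply cser_cv in H. apply (cser_scal z) in H. apply cser_cv.
  replace (z * s1)%C with (RtoC (INR 0) * a 0%nat * z ^ 0 + z * s1)%C by (simpl; ring).
  apply (cser_S (fun k => (RtoC (INR k) * a k * z ^ k)%C)).
  eapply cser_ext; [|exact H]. intros k. unfold dcoef. rewrite Cpow_S. ring.
Qed.

(* The Schwarz lemma of order [n] for [(Q_g - 1) / (Q_g + 1 - 2 alpha)]. *)
Lemma starlike_bound (n : nat) (alpha : R) (g : C -> C) : (1 <= n)%nat -> alpha < 1 ->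
  Sstar_n n alpha g ->
  forall z q, Cmod z < 1 -> z <> 0%C -> Qf_is g z q ->
  Cmod (q - 1) * (1 - Cmod z ^ n) <= 2 * (1 - alpha) * Cmod z ^ n.
Proof.
  intros Hn Hal [(a & Ha0 & Ha1 & Han & Hcv) HS].
  change (a 0%nat = RtoC 0) in Ha0. change (a 1%nat = RtoC 1) in Ha1.
  change (forall k, (2 <= k)%nat -> (k <= n)%nat -> a k = RtoC 0) in Han.
  change (forall w, Cmod w < 1 -> Cseries_cv a w (g w)) in Hcv.
  change (forall z, Cmod z < 1 -> z <> RtoC 0 -> exists q, Qf_is g z q /\ alpha < fst q) in HS.
  destruct (power_series_deriv a g Hcv) as (g1 & Hg1 & Hga & Hg1a).
  assert (Hana : forall z, Cmod z < 1 -> ana g z (g1 z)) by exact Hga.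
  assert (HQ : forall z, Cmod z < 1 -> z <> 0%C -> g z <> 0%C /\ alpha < fst (z * g1 z / g z)%C).
  { intros z Hz Hz0. destruct (HS z Hz Hz0) as (q & Hq & Hre).
    apply (Qf_is_iff _ _ _ _ (Hana z Hz)) in Hq. destruct Hq as [Hgz ->]. auto. }
  set (Q := fun z => (z * g1 z / g z)%C) in *.
  set (D := fun z => (Q z + RtoC (1 - 2 * alpha))%C).
  assert (HD : forall z, Cmod z < 1 -> z <> 0%C -> 1 - alpha <= Cmod (D z)).
  { intros z Hz Hz0. destruct (HQ z Hz Hz0) as [_ H]. fold (Q z) in H.
    assert (X := fst_le_Cmod (D z)).
    assert (E : fst (D z) = fst (Q z) + (1 - 2 * alpha)) by reflexivity.
    rewrite E, Rabs_pos_eq in X; lra. }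
  assert (HDn : forall z, Cmod z < 1 -> z <> 0%C -> D z <> 0%C).
  { intros z Hz Hz0 E. specialize (HD z Hz Hz0). rewrite E, Cmod_0 in HD. lra. }
  set (om := fun z => ((Q z - 1) / D z)%C).
  assert (Hom : forall z, Cmod z < 1 -> z <> 0%C -> Cmod (om z / z ^ n)%C <= 1).
  { apply schwarz_order.
    - intros z Hz Hz0. destruct (Hg1a z Hz) as (b & c & Hc).
      assert (Hb : ana g1 z b) by (exists c; exact Hc).
      destruct (HQ z Hz Hz0) as [Hgz _].
      assert (HQa : exists c, ana Q z c).
      { eexists. unfold Q. apply ana_div; [apply ana_mult; [apply ana_id | exact Hb] | apply Hana; auto | auto]. }
      destruct HQa as [c' HQa]. eexists. unfold om, D.
      apply ana_div; [apply ana_minus | apply ana_plus | apply HDn; auto]; try exact HQa; apply ana_const.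
    - intros z Hz Hz0. unfold om. rewrite Cmod_div by auto. assert (X := HD z Hz Hz0).
      apply Rle_div_l; [lra|]. rewrite Rmult_1_l.
      destruct (HQ z Hz Hz0) as [_ H]. fold (Q z) in H.
      unfold D, Cmod. apply sqrt_le_1_alt. destruct (Q z) as [u w]; simpl in *. nra.
    (* The coefficients (k - 1) a_k of z g' - g vanish for k <= n, so this function is O(|z|^(n+1));
       division by g, which has size |z|, leaves Q - 1 = O(|z|^n). *)
    - destruct (power_series_order (fun k => RtoC (INR k) * a k - a k)%C (fun z => z * g1 z - g z)%C (S n))
        as (K1 & HK1 & HB1).
      { intros w Hw. apply cser_cv.
        eapply cser_ext; [|exact (cser_minus _ _ _ _ (proj1 (cser_cv _ _ _) (cser_euler _ _ _ (Hg1 w Hw)))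
             (proj1 (cser_cv _ _ _) (Hcv w Hw)))]. intros k; simpl; ring. }
      { intros k Hk. destruct k as [|[|k]].
        - rewrite Ha0. ring.
        - rewrite Ha1. simpl. ring.
        - rewrite Han by lia. ring. }
      (* From |g z - z| <= K2 |z|^2 follows |g z| >= |z|/2 once |z| < 1/(2 K2 + 1). *)
      destruct (power_series_order (fun k => match k with O | 1%nat => RtoC 0 | _ => a k end)
         (fun z => g z - z)%C 2) as (K2 & HK2 & HB2).
      { intros w Hw. apply cser_cv.
        assert (X := cser_tail _ _ _ (Hcv w Hw)). rewrite Ha0 in X.
        assert (X2 : cser (fun k => match k with 1%nat => w | _ => RtoC 0 end) w).
        { set (u := fun k : nat => match k with 1%nat => w | _ => RtoC 0 end).
          assert (X2 : cser u (u 0%nat + (u 1%nat + 0))%C);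
            [|now replace (u 0%nat + (u 1%nat + 0))%C with w in X2 by (simpl; ring)].
          apply (cser_S u), (cser_S (fun k => u (S k))).
          assert (Z : is_series (fun _ : nat => 0) 0).
          { apply filterlim_ext with (fun _ => 0); [|apply filterlim_const].
            intros N. rewrite sum_n_const. simpl. ring. }
          split; exact Z. }
        replace (g w - w)%C with (g w - 0 - w)%C by ring.
        eapply cser_ext; [|exact (cser_minus _ _ _ _ X X2)].
        intros [|[|k]]; simpl; try ring. rewrite Ha1. ring. }
      { intros [|[|k]] Hk; auto; lia. }
      exists (2 * K1 / (1 - alpha)), (Rmin (1 / 2) (/ (2 * K2 + 1))).
      assert (HKi : 0 < / (2 * K2 + 1)) by (apply Rinv_0_lt_compat; lra).
      split; [apply Rmult_le_pos; [lra|apply Rlt_le, Rinv_0_lt_compat; lra]|].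
      split; [apply Rmin_glb_lt; lra|].
      intros z Hz Hz0.
      assert (z1 : Cmod z < 1 / 2) by (eapply Rlt_le_trans; [apply Hz | apply Rmin_l]).
      assert (z2 : Cmod z < / (2 * K2 + 1)) by (eapply Rlt_le_trans; [apply Hz | apply Rmin_r]).
      assert (Hzp : 0 < Cmod z) by (apply Cmod_gt_0; auto).
      specialize (HB1 z ltac:(lra)). specialize (HB2 z ltac:(lra)).
      assert (Hlow : Cmod z / 2 <= Cmod (g z)).
      { assert (X := Cmod_sub_le z (z - g z)%C). replace (z - (z - g z))%C with (g z) in X by ring.
        rewrite (Cmod_minus_sym z) in X.
        assert ((2 * K2 + 1) * Cmod z < 1).
        { apply Rmult_lt_reg_l with (/ (2 * K2 + 1)); auto. rewrite <- Rmult_assoc, Rinv_l by lra. lra. }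
        simpl in HB2. nra. }
      destruct (HQ z ltac:(lra) Hz0) as [Hgz _].
      assert (HQ1 : Cmod (Q z - 1) <= 2 * K1 * Cmod z ^ n).
      { replace (Q z - 1)%C with ((z * g1 z - g z) / g z)%C by (unfold Q; field; auto).
        rewrite Cmod_div by auto. apply Rle_div_l; [lra|].
        eapply Rle_trans; [exact HB1|].
        assert (0 <= K1 * Cmod z ^ n) by (apply Rmult_le_pos; [auto|apply pow_le; lra]).
        simpl. nra. }
      assert (X := HD z ltac:(lra) Hz0).
      unfold om. rewrite Cmod_div by (apply HDn; auto; lra). apply Rle_div_l; [lra|].
      eapply Rle_trans; [exact HQ1|].
      assert (0 <= 2 * K1 / (1 - alpha) * Cmod z ^ n).
      { apply Rmult_le_pos; [apply Rmult_le_pos; [lra|apply Rlt_le, Rinv_0_lt_compat; lra]|apply pow_le; lra]. }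
      apply Rle_trans with (2 * K1 / (1 - alpha) * Cmod z ^ n * (1 - alpha)); [right; field; lra|].
      apply Rmult_le_compat_l; auto. }
  intros z q Hz Hz0 Hq.
  apply (Qf_is_iff _ _ _ _ (Hana z Hz)) in Hq. destruct Hq as [Hgz Hq]. fold (Q z) in Hq.
  specialize (Hom z Hz Hz0).
  assert (Hzp : 0 < Cmod z) by (apply Cmod_gt_0; auto).
  assert (Hx : 0 < Cmod z ^ n) by (apply pow_lt; auto).
  rewrite Cmod_div, Cmod_pow in Hom by (apply Cpow_nz; auto).
  apply Rle_div_l in Hom; auto. rewrite Rmult_1_l in Hom.
  (* Since D = (q - 1) + 2 (1 - alpha), the bound |om| <= |z|^n becomes a linear inequality in |q -
     1|. *)
  assert (E : (q - 1)%C = (om z * D z)%C).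
  { rewrite Hq. unfold om. field. apply HDn; auto. }
  assert (X : Cmod (D z) <= Cmod (q - 1) + 2 * (1 - alpha)).
  { replace (D z) with ((q - 1) + RtoC (2 * (1 - alpha)))%C.
    - eapply Rle_trans; [apply Cmod_triangle|]. rewrite Cmod_R, Rabs_pos_eq; lra.
    - rewrite Hq. unfold D. rewrite RtoC_mult, !RtoC_minus, RtoC_mult. ring. }
  assert (Y : Cmod (q - 1) = Cmod (om z) * Cmod (D z)) by (rewrite E; apply Cmod_mult).
  assert (P1 := Cmod_ge_0 (om z)). assert (P2 := Cmod_ge_0 (D z)).
  assert (Cmod (om z) * Cmod (D z) <= Cmod z ^ n * (Cmod (q - 1) + 2 * (1 - alpha)))
    by (apply Rmult_le_compat; auto).
  lra.
Qed.

Lemma P_n_facts (n : nat) (p : C -> C) : (1 <= n)%nat -> P_n n p ->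
  exists p1 : C -> C, (forall z, Cmod z < 1 -> ana p z (p1 z)) /\
    (forall z, Cmod z < 1 -> p z <> 0%C) /\
    forall z, Cmod z < 1 -> z <> 0%C ->
      Cmod (z * p1 z / p z)%C * (1 - (Cmod z ^ n) ^ 2) <= 2 * INR n * Cmod z ^ n.
Proof.
  intros Hn [(c & Hc0 & Hcn & Hcv) Hre].
  change (c 0%nat = RtoC 1) in Hc0.
  change (forall k, (1 <= k)%nat -> (k < n)%nat -> c k = RtoC 0) in Hcn.
  change (forall w, Cmod w < 1 -> Cseries_cv c w (p w)) in Hcv.
  change (forall w, Cmod w < 1 -> 0 < fst (p w)) in Hre.
  destruct (power_series_deriv c p Hcv) as (p1 & _ & Hpa & _).
  exists p1. split; [exact Hpa|]. split.
  { intros z Hz E. specialize (Hre z Hz). rewrite E in Hre. simpl in Hre. lra. }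
  intros z Hz Hz0. apply caratheodory_log_deriv; auto.
  - intros w Hw. exists (p1 w). exact (Hpa w Hw).
  - destruct (power_series_order (fun k => match k with O => RtoC 0 | _ => c k end)
         (fun z => p z - 1)%C n) as (K & HK & HB).
    + intros w Hw. apply cser_cv. rewrite <- Hc0. apply cser_tail; auto.
    + intros [|k] Hk; auto. apply Hcn; lia.
    + exists K, (1 / 2). split; [auto|]. split; [lra|]. intros w Hw. apply HB. lra.
  - exact (Hpa z Hz).
Qed.

Lemma CSstar_maps_into_OmegaNe (n : nat) (alpha : R) (f : C -> C) (z : C) :
  (1 <= n)%nat -> 0 <= alpha < 1 -> CSstar_n n alpha f ->
  Cmod z < 1 -> z <> 0%C ->
  (4 - 3 * alpha) * (Cmod z ^ n) ^ 2 + 3 * (1 + INR n - alpha) * Cmod z ^ n < 1 ->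
  exists q, Qf_is f z q /\ OmegaNe q.
Proof.
  intros Hn Hal [_ (g & p & Hg & Hp & Hf)] Hz Hz0 Hx.
  change (forall w, Cmod w < 1 -> f w = (g w * p w)%C) in Hf.
  destruct (P_n_facts n p Hn Hp) as (p1 & Hpa & Hpn & HpB).
  destruct (proj2 Hg z Hz Hz0) as (qg & Hqg & _).
  assert (HgB := starlike_bound n alpha g Hn ltac:(lra) Hg z qg Hz Hz0 Hqg).
  specialize (HpB z Hz Hz0).
  assert (Hga : exists b, ana g z b).
  { destruct Hg as [(a & _ & _ & _ & Hcv) _].
    destruct (power_series_deriv a g Hcv) as (g1 & _ & Hga & _). exists (g1 z). exact (Hga z Hz). }
  destruct Hga as [b Hga].
  exists (qg + z * p1 z / p z)%C. split.
  - apply (Qf_product f g p z b (p1 z)); auto.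
  - apply OmegaNe_disc.
    replace (qg + z * p1 z / p z - 1)%C with ((qg - 1) + z * p1 z / p z)%C by ring.
    eapply Rle_lt_trans; [apply Cmod_triangle|].
    assert (Hzp : 0 < Cmod z) by (apply Cmod_gt_0; auto).
    assert (Hx0 : 0 < Cmod z ^ n) by (apply pow_lt; auto).
    assert (Hx1 : Cmod z ^ n < 1) by (apply pow_lt_1_compat; [lra|lia]).
    set (x := Cmod z ^ n) in *.
    set (A := Cmod (qg - 1)) in *. set (B := Cmod (z * p1 z / p z)%C) in *.
    (* After multiplication by 1 - x^2 = (1 - x)(1 + x), the required inequality is 2/3 times the
       hypothesis on x. *)
    apply Rmult_lt_reg_r with (1 - x ^ 2); [nra|].
    assert (S1 := Rmult_le_compat_r (1 + x) _ _ ltac:(lra) HgB).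
    lra.
Qed.

(** * The extremal function *)

Lemma tame_le (a a' : nat -> C) :
  (forall k, Cmod (a k) <= Cmod (a' k)) -> tame a' -> tame a.
Proof.
  intros H Ha rho Hr. destruct (Ha rho Hr) as [M HM]. exists M. intros k.
  eapply Rle_trans; [|apply (HM k)]. apply Rmult_le_compat_r; auto. apply pow_le; lra.
Qed.

Lemma tame_one : tame (fun _ => RtoC 1).
Proof.
  intros rho Hr. exists 1. intros k. rewrite Cmod_1, Rmult_1_l.
  rewrite <- (pow1 k). apply pow_incr; lra.
Qed.

Lemma Cseries_cv_unique (a : nat -> C) (z s t : C) : Cseries_cv a z s -> Cseries_cv a z t -> s = t.
Proof. intros H1 H2. apply cser_cv in H1, H2. eapply cser_unique; eauto. Qed.

Lemma Cseries_cv_ext (a b : nat -> C) (z s : C) :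
  (forall k, a k = b k) -> Cseries_cv a z s -> Cseries_cv b z s.
Proof.
  intros E H. apply cser_cv. apply cser_cv in H. eapply cser_ext; [|exact H].
  intros k; simpl; now rewrite E.
Qed.

Lemma Cseries_cv_plus (a b : nat -> C) (z s t : C) :
  Cseries_cv a z s -> Cseries_cv b z t -> Cseries_cv (fun k => a k + b k)%C z (s + t)%C.
Proof.
  intros H1 H2. apply cser_cv in H1, H2. apply cser_cv.
  eapply cser_ext; [|exact (cser_plus _ _ _ _ H1 H2)]. intros k; simpl; ring.
Qed.

Lemma Cseries_cv_scal (c : C) (a : nat -> C) (z s : C) :
  Cseries_cv a z s -> Cseries_cv (fun k => c * a k)%C z (c * s)%C.
Proof.
  intros H1. apply cser_cv in H1. apply cser_cv.
  eapply cser_ext; [|exact (cser_scal c _ _ H1)]. intros k; simpl; ring.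
Qed.

Definition shift (a : nat -> C) (k : nat) : C := match k with O => RtoC 0 | S j => a j end.

Lemma Cseries_cv_shift (a : nat -> C) (z s : C) :
  Cseries_cv a z s -> Cseries_cv (shift a) z (z * s)%C.
Proof.
  intros H. apply cser_cv in H. apply cser_cv.
  replace (z * s)%C with (shift a 0 * z ^ 0 + z * s)%C by (simpl; ring).
  apply (cser_S (fun k => (shift a k * z ^ k)%C)).
  eapply cser_ext; [|exact (cser_scal z _ _ H)]. intros k. rewrite Cpow_S. simpl. ring.
Qed.

(* Coefficients of the power series [z |-> sum_k a_k (z^n)^k]. *)
Definition lac (n : nat) (a : nat -> C) (m : nat) : C :=
  if Nat.eqb (m mod n) 0 then a (m / n)%nat else RtoC 0.

(** From N to N + 1 the quotient by n grows only when n divides N + 1, which is exactly when a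
    possibly nonzero term is added. *)
Lemma sum_lacunary (n : nat) (x y : nat -> R) (N : nat) : (1 <= n)%nat ->
  (forall k, x (n * k)%nat = y k) -> (forall m, (m mod n <> 0)%nat -> x m = 0) ->
  sum_f_R0 x N = sum_f_R0 y (N / n).
Proof.
  intros Hn Hx H0.
  induction N as [|N IH].
  - rewrite Nat.Div0.div_0_l. simpl. rewrite <- (Hx 0%nat). f_equal. lia.
  - rewrite tech5, IH.
    assert (D := Nat.div_mod_eq (S N) n). assert (D' := Nat.div_mod_eq N n).
    assert (L' := Nat.mod_upper_bound N n ltac:(lia)).
    assert (L := Nat.mod_upper_bound (S N) n ltac:(lia)).
    destruct (Nat.eq_dec (S N mod n) 0) as [E|E].
    + rewrite E, Nat.add_0_r in D.
      destruct (S N / n)%nat as [|k] eqn:Ek; [lia|].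
      assert (N / n = k)%nat.
      { symmetry. apply (Nat.div_unique N n k (n - 1)); [lia|].
        rewrite Nat.mul_succ_r in D. lia. }
      rewrite tech5, H, D, Hx. reflexivity.
    + rewrite H0 by auto. rewrite Rplus_0_r. f_equal. symmetry.
      apply (Nat.div_unique N n _ (S N mod n - 1)); lia.
Qed.

Lemma Cseries_cv_lac (n : nat) (a : nat -> C) (z s : C) : (1 <= n)%nat ->
  Cseries_cv a (z ^ n)%C s -> Cseries_cv (lac n a) z s.
Proof.
  intros Hn [H1 H2].
  assert (G : forall x y l, (forall k, x (n * k)%nat = y k) -> (forall m, (m mod n <> 0)%nat -> x m = 0) ->
     Un_cv (fun N => sum_f_R0 y N) l -> Un_cv (fun N => sum_f_R0 x N) l).
  { intros x y l Hx H0 H eps He. destruct (H eps He) as [N0 HN0]. exists (n * N0)%nat.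
    intros N HN. rewrite (sum_lacunary n x y N Hn Hx H0). apply HN0.
    apply Nat.div_le_lower_bound; lia. }
  assert (L1 : forall k, (lac n a (n * k) * z ^ (n * k) = a k * (z ^ n) ^ k)%C).
  { intros k. unfold lac. rewrite Nat.mul_comm, Nat.Div0.mod_mul, Nat.eqb_refl, Nat.div_mul by lia.
    rewrite Nat.mul_comm, Cpow_mult_r. reflexivity. }
  assert (L2 : forall m, (m mod n <> 0)%nat -> (lac n a m * z ^ m = 0)%C).
  { intros m Hm. unfold lac. apply Nat.eqb_neq in Hm. rewrite Hm. ring. }
  split.
  - apply (G _ _ _ (fun k => f_equal fst (L1 k)) (fun m Hm => f_equal fst (L2 m Hm)) H1).
  - apply (G _ _ _ (fun k => f_equal snd (L1 k)) (fun m Hm => f_equal snd (L2 m Hm)) H2).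
Qed.

(** * The binomial series (1 - w)^(-beta) *)

(** Coefficients of the series of a divided by 1 - w: the Cauchy product with the geometric
    series. *)
Fixpoint psum (a : nat -> C) (k : nat) : C :=
  match k with O => a O | S j => (psum a j + a (S j))%C end.

Lemma psum_series (a : nat -> C) (w s t : C) :
  Cseries_cv a w s -> Cseries_cv (psum a) w t -> ((1 - w) * t = s)%C.
Proof.
  intros Ha Ht. apply (Cseries_cv_unique a w); auto.
  replace ((1 - w) * t)%C with (t + (-(1)) * (w * t))%C by ring.
  eapply Cseries_cv_ext; [|exact (Cseries_cv_plus _ _ _ _ _ Ht (Cseries_cv_scal _ _ _ _ (Cseries_cv_shift _ _ _ Ht)))].
  intros [|k]; simpl; ring.
Qed.

(* Taylor coefficients of (1 - w)^(-beta). *)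
Fixpoint bcoef (beta : R) (k : nat) : R :=
  match k with O => 1 | S j => bcoef beta j * (beta + INR j) / INR (S j) end.

(** The upper bound is the case beta = 2, since (1 - w)^(-2) has coefficients k + 1. The range
    suffices as beta = 2 (1 - alpha)/n in the application. *)
Lemma bcoef_bound (beta : R) (k : nat) : 0 <= beta <= 2 -> 0 <= bcoef beta k <= INR (S k).
Proof.
  intros Hb. induction k as [|k [IH0 IH]]; [simpl; lra|].
  change (bcoef beta (S k)) with (bcoef beta k * (beta + INR k) / INR (S k)).
  rewrite (S_INR (S k)), S_INR in *. assert (0 <= INR k) by apply pos_INR.
  split.
  - apply Rle_div_r; [lra|]. rewrite Rmult_0_l. apply Rmult_le_pos; lra.
  - apply Rle_div_l; [lra|]. nra.
Qed.

Lemma bcoef_tame (beta : R) : 0 <= beta <= 2 -> tame (fun k => RtoC (bcoef beta k)).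
Proof.
  intros Hb. eapply tame_le; [|apply (tame_deg _ tame_one)].
  intros k. cbv beta. rewrite Cmod_mult, Cmod_1, !Cmod_R, (Rabs_pos_eq (INR _)) by apply pos_INR.
  destruct (bcoef_bound beta k Hb). rewrite Rabs_pos_eq; lra.
Qed.

Lemma psum_bcoef_tame (beta : R) : 0 <= beta <= 2 -> tame (psum (fun k => RtoC (bcoef beta k))).
Proof.
  intros Hb. eapply tame_le; [|apply (tame_deg _ (tame_deg _ tame_one))].
  intros k. cbv beta. rewrite !Cmod_mult, Cmod_1, !Cmod_R, (Rabs_pos_eq (INR _)) by apply pos_INR.
  induction k as [|k IH].
  - simpl. rewrite Cmod_1. lra.
  - change (psum (fun k => RtoC (bcoef beta k)) (S k))
      with (psum (fun k => RtoC (bcoef beta k)) k + RtoC (bcoef beta (S k)))%C.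
    eapply Rle_trans; [apply Cmod_triangle|].
    destruct (bcoef_bound beta (S k) Hb). rewrite Cmod_R, Rabs_pos_eq by auto.
    rewrite (S_INR (S k)) in *. assert (0 <= INR (S k)) by apply pos_INR. nra.
Qed.

(** The recursion (k + 1) b_(k+1) = (beta + k) b_k, read as h' = beta h + w h'. *)
Lemma binomial_ode (beta : R) (w h h1 : C) :
  Cseries_cv (fun k => RtoC (bcoef beta k)) w h ->
  Cseries_cv (dcoef (fun k => RtoC (bcoef beta k))) w h1 ->
  ((1 - w) * h1 = RtoC beta * h)%C.
Proof.
  intros H H1.
  assert (E : h1 = (RtoC beta * h + w * h1)%C).
  { apply (Cseries_cv_unique _ _ _ _ H1).
    eapply Cseries_cv_ext; [|exact (Cseries_cv_plus _ _ _ _ _ (Cseries_cv_scal (RtoC beta) _ _ _ H) (cser_euler _ _ _ H1))].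
    intros k. unfold dcoef. cbn [bcoef]. rewrite <- !RtoC_mult, <- RtoC_plus. f_equal.
    field. apply not_0_INR. lia. }
  replace ((1 - w) * h1)%C with (h1 - w * h1)%C by ring. rewrite E at 1. ring.
Qed.

Lemma ray_derive (F : C -> C) (w b : C) (t : R) : ana F (RtoC t * w)%C b ->
  is_derive (fun s => fst (F (RtoC s * w)%C)) t (fst (w * b)%C) /\
  is_derive (fun s => snd (F (RtoC s * w)%C)) t (snd (w * b)%C).
Proof.
  intros [c (K & d & HK & Hd & H)].
  assert (L : exists M e, 0 <= M /\ 0 < e /\ forall s, Rabs s < e ->
     Cmod (F (RtoC (t + s) * w) - F (RtoC t * w) - RtoC s * (w * b))%C <= M * Rabs s ^ 2).
  { assert (Hw := Cmod_ge_0 w). assert (Hc := Cmod_ge_0 c).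
    exists (Cmod c * Cmod w ^ 2 + K * Cmod w ^ 3), (Rmin 1 (d / (Cmod w + 1))).
    assert (W2 : 0 <= Cmod w ^ 2) by (apply pow_le; auto).
    assert (W3 : 0 <= Cmod w ^ 3) by (apply pow_le; auto).
    split; [apply Rplus_le_le_0_compat; apply Rmult_le_pos; auto|].
    assert (He : 0 < d / (Cmod w + 1)) by (apply Rdiv_lt_0_compat; lra).
    split; [apply Rmin_glb_lt; lra|]. intros s Hs.
    assert (s1 : Rabs s < 1) by (eapply Rlt_le_trans; [apply Hs | apply Rmin_l]).
    assert (s2 : Rabs s < d / (Cmod w + 1)) by (eapply Rlt_le_trans; [apply Hs | apply Rmin_r]).
    assert (Hs0 := Rabs_pos s).
    assert (Hm : Cmod (RtoC s * w) = Rabs s * Cmod w) by (rewrite Cmod_mult, Cmod_R; auto).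
    assert (Hsd : Cmod (RtoC s * w) < d).
    { rewrite Hm. assert (d = d / (Cmod w + 1) * (Cmod w + 1)) by (field; lra). nra. }
    specialize (H _ Hsd). rewrite Hm in H.
    set (h := (RtoC s * w)%C) in *.
    replace (RtoC (t + s) * w)%C with (RtoC t * w + h)%C by (unfold h; rewrite RtoC_plus; ring).
    set (E := (F (RtoC t * w + h) - (F (RtoC t * w) + b * h + c * h ^ 2))%C) in *.
    replace (F (RtoC t * w + h) - F (RtoC t * w) - RtoC s * (w * b))%C
      with (c * h ^ 2 + E)%C by (unfold E, h; ring).
    eapply Rle_trans; [apply Cmod_triangle|]. rewrite Cmod_mult, Cmod_pow, Hm.
    rewrite !Rpow_mult_distr in *.
    assert (Rabs s ^ 3 <= Rabs s ^ 2) by (simpl; nra).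
    assert (K * (Rabs s ^ 3 * Cmod w ^ 3) <= K * (Rabs s ^ 2 * Cmod w ^ 3)).
    { apply Rmult_le_compat_l; auto. apply Rmult_le_compat_r; auto. }
    nra. }
  destruct L as (M & e & HM & He & L).
  (* Both coordinates are treated at once, as real-linear maps bounded by the modulus. *)
  assert (G : forall (pr : C -> R), (forall u v, pr (u - v)%C = pr u - pr v) ->
      (forall (s : R) u, pr (RtoC s * u)%C = s * pr u) ->
      (forall u, Rabs (pr u) <= Cmod u) ->
      is_derive (fun s => pr (F (RtoC s * w)%C)) t (pr (w * b)%C)).
  { intros pr P1 P2 P3. apply is_derive_Reals. intros eps Heps.
    assert (Hd' : 0 < Rmin e (eps / (M + 1))).
    { apply Rmin_glb_lt; auto. apply Rdiv_lt_0_compat; lra. }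
    exists (mkposreal _ Hd'). intros s Hs0 Hs. simpl in Hs.
    assert (s1 : Rabs s < e) by (eapply Rlt_le_trans; [apply Hs | apply Rmin_l]).
    assert (s2 : Rabs s < eps / (M + 1)) by (eapply Rlt_le_trans; [apply Hs | apply Rmin_r]).
    specialize (L s s1).
    assert (X := P3 (F (RtoC (t + s) * w) - F (RtoC t * w) - RtoC s * (w * b))%C).
    rewrite !P1, P2 in X.
    assert (Hsp : 0 < Rabs s) by (apply Rabs_pos_lt; auto).
    replace ((pr (F (RtoC (t + s) * w)%C) - pr (F (RtoC t * w)%C)) / s - pr (w * b)%C)
      with ((pr (F (RtoC (t + s) * w)%C) - pr (F (RtoC t * w)%C) - s * pr (w * b)%C) / s) by (field; auto).
    unfold Rdiv. rewrite Rabs_mult, Rabs_inv.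
    apply (Rlt_div_l _ _ _ Hsp).
    assert (eps = (M + 1) * (eps / (M + 1))) by (field; lra).
    assert (M * Rabs s < eps) by nra.
    simpl in L. nra. }
  split.
  - apply (G (fun u => fst u)); [reflexivity| |apply fst_le_Cmod]. intros s [x y]; simpl; ring.
  - apply (G (fun u => snd u)); [reflexivity| |apply snd_le_Cmod]. intros s [x y]; simpl; ring.
Qed.

(* Along a ray, (log |h|^2)' is bounded because h'/h = beta / (1 - w). *)
Lemma binomial_nonzero (beta : R) (h h1 : C -> C) : 0 <= beta ->
  (forall w, Cmod w < 1 -> ana h w (h1 w)) ->
  (forall w, Cmod w < 1 -> ((1 - w) * h1 w = RtoC beta * h w)%C) ->
  h 0%C = 1%C -> forall w, Cmod w < 1 -> h w <> 0%C.
Proof.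
  intros Hb Ha Hode H0 w Hw E.
  assert (Hw0 := Cmod_ge_0 w).
  set (M := 2 * (beta / (1 - Cmod w))).
  set (x := fun t => fst (h (RtoC t * w)%C)). set (y := fun t => snd (h (RtoC t * w)%C)).
  set (dx := fun t => fst (w * h1 (RtoC t * w))%C). set (dy := fun t => snd (w * h1 (RtoC t * w))%C).
  assert (Ht : forall t, 0 <= t <= 1 -> Cmod (RtoC t * w) <= Cmod w).
  { intros t Ht. rewrite Cmod_mult, Cmod_R, Rabs_pos_eq by lra. nra. }
  (* M is twice a bound for |w h'/h| on the segment, so |h|^2 exp(M t) is nondecreasing; it starts
     at 1 and cannot reach 0 at t = 1. *)
  set (v := fun t => (x t ^ 2 + y t ^ 2) * exp (M * t)).
  set (dv := fun t => (2 * (x t * dx t + y t * dy t) + M * (x t ^ 2 + y t ^ 2)) * exp (M * t)).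
  assert (Hv : forall t, 0 <= t <= 1 -> is_derive v t (dv t)).
  { intros t Ht1. specialize (Ht t Ht1).
    destruct (ray_derive h w _ t (Ha (RtoC t * w)%C ltac:(lra))) as [D1 D2].
    fold x in D1. fold y in D2. fold (dx t) in D1. fold (dy t) in D2.
    unfold v, dv. auto_derive.
    - repeat split; eexists; eassumption.
    - replace (Derive (fun x0 => x x0) t) with (dx t) by (symmetry; apply is_derive_unique; exact D1).
      replace (Derive (fun x0 => y x0) t) with (dy t) by (symmetry; apply is_derive_unique; exact D2).
      ring. }
  assert (Hdv : forall t, 0 <= t <= 1 -> 0 <= dv t).
  { intros t Ht1. specialize (Ht t Ht1). unfold dv. apply Rmult_le_pos; [|apply Rlt_le, exp_pos].
    set (u := (RtoC t * w)%C) in *.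
    assert (D : x t * dx t + y t * dy t = fst (Cconj (h u) * (w * h1 u))%C).
    { unfold x, y, dx, dy. fold u. destruct (h u), (w * h1 u)%C; simpl; ring. }
    assert (S : x t ^ 2 + y t ^ 2 = Cmod (h u) ^ 2) by (rewrite Cmod2_alt; reflexivity).
    rewrite D, S.
    assert (B := fst_le_Cmod (Cconj (h u) * (w * h1 u))%C).
    rewrite !Cmod_mult, Cmod_conj in B.
    assert (B2 : Cmod (h1 u) <= beta / (1 - Cmod w) * Cmod (h u)).
    { assert (O := f_equal Cmod (Hode u ltac:(lra))).
      rewrite !Cmod_mult, Cmod_R, Rabs_pos_eq in O by auto.
      assert (L := Cmod_sub_le 1 u). rewrite Cmod_1 in L.
      assert (P := Cmod_ge_0 (h1 u)).
      replace (beta / (1 - Cmod w) * Cmod (h u)) with (beta * Cmod (h u) / (1 - Cmod w)) by (field; lra).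
      apply Rle_div_r; [lra|]. rewrite <- O, Rmult_comm. apply Rmult_le_compat_r; lra. }
    assert (P := Cmod_ge_0 (h u)). assert (P1 := Cmod_ge_0 (h1 u)).
    assert (B3 : Cmod (h u) * (Cmod w * Cmod (h1 u)) <= beta / (1 - Cmod w) * Cmod (h u) ^ 2).
    { apply Rle_trans with (Cmod (h u) * Cmod (h1 u)).
      - apply Rmult_le_compat_l; auto. nra.
      - simpl. nra. }
    apply Rabs_le_between in B. unfold M. lra. }
  destruct (MVT_gen v 0 1 dv) as (c & Hc & HE).
  - intros t Ht1. rewrite Rmin_left, Rmax_right in Ht1 by lra. apply Hv. lra.
  - intros t Ht1. rewrite Rmin_left, Rmax_right in Ht1 by lra.
    apply derivable_continuous_pt. exists (dv t). apply is_derive_Reals, Hv. lra.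
  - rewrite Rmin_left, Rmax_right in Hc by lra. specialize (Hdv c Hc).
    assert (V0 : v 0 = 1).
    { unfold v, x, y. replace (RtoC 0 * w)%C with (RtoC 0) by ring. rewrite H0, Rmult_0_r, exp_0. simpl. ring. }
    assert (V1 : v 1 = 0).
    { unfold v, x, y. replace (RtoC 1 * w)%C with w by ring. rewrite E. simpl. ring. }
    lra.
Qed.

Lemma Cseries_cv_at_0 (a : nat -> C) (s : C) : Cseries_cv a (RtoC 0) s -> s = a 0%nat.
Proof.
  intros H. apply (Cseries_cv_unique _ _ _ _ H). apply cser_cv.
  set (u := fun k => (a k * 0 ^ k)%C).
  assert (X : cser u (u 0%nat + 0 * s)%C);
    [|now replace (u 0%nat + 0 * s)%C with (a 0%nat) in X by (unfold u; simpl; ring)].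
  apply (cser_S u). eapply cser_ext; [|exact (cser_scal 0 _ _ (proj1 (cser_cv _ _ _) H))].
  intros k. unfold u. cbv beta. rewrite Cpow_S. ring.
Qed.

Lemma lacunary_A_n (n : nat) (a : nat -> C) (F f : C -> C) : (1 <= n)%nat -> a 0%nat = 1%C ->
  (forall w, Cmod w < 1 -> Cseries_cv a w (F w)) ->
  (forall z, f z = (z * F (z ^ n))%C) ->
  A_n n f /\ (forall z, Cmod z < 1 -> Cseries_cv (shift (lac n a)) z (f z)).
Proof.
  intros Hn Ha0 HF Hf.
  assert (Hcv : forall z, Cmod z < 1 -> Cseries_cv (shift (lac n a)) z (f z)).
  { intros z Hz. rewrite Hf. apply Cseries_cv_shift, Cseries_cv_lac; auto. apply HF.
    rewrite Cmod_pow. apply pow_lt_1_compat; [split; [apply Cmod_ge_0 | auto] | lia]. }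
  split; [|exact Hcv].
  exists (shift (lac n a)). split; [reflexivity|]. split; [|split; [|exact Hcv]].
  - simpl. unfold lac. rewrite Nat.Div0.mod_0_l, Nat.Div0.div_0_l. exact Ha0.
  - intros [|k] H2 Hk; [lia|]. simpl. unfold lac.
    rewrite Nat.mod_small by lia. destruct k; [lia|]. reflexivity.
Qed.

Lemma one_minus_nonzero (w : C) : Cmod w < 1 -> (1 - w)%C <> 0%C.
Proof.
  intros Hw E. assert (X := Cmod_sub_le 1 w). rewrite E, Cmod_0, Cmod_1 in X. lra.
Qed.

Lemma cayley_re_pos (w : C) : Cmod w < 1 -> 0 < fst ((1 + w) / (1 - w))%C.
Proof.
  intros Hw. assert (H := one_minus_nonzero w Hw).
  assert (Hd : 0 < Cmod (1 - w) ^ 2) by (apply pow_lt, Cmod_gt_0; auto).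
  assert (Hn : 0 < 1 - Cmod w ^ 2) by (assert (P := Cmod_ge_0 w); nra).
  rewrite Cmod2_alt in Hd, Hn. destruct w as [x y].
  unfold Cdiv, Cinv, Cmult, Cminus, Cplus, Copp, RtoC, Re, Im in *; simpl fst in *; simpl snd in *.
  match goal with |- 0 < ?e => replace e with ((1 - (x ^ 2 + y ^ 2)) / ((1 + - x) ^ 2 + (0 + - y) ^ 2)) by (field; lra) end.
  apply Rdiv_lt_0_compat; lra.
Qed.

(* f = z (1 + z^n) / (1 - z^n)^(beta + 1), as the product of g = z / (1 - z^n)^beta and
   p = (1 + z^n) / (1 - z^n), with n beta = 2 (1 - alpha). *)
Lemma extremal_function (n : nat) (alpha : R) : (1 <= n)%nat -> 0 <= alpha < 1 ->
  exists f, CSstar_n n alpha f /\ forall z, Cmod z < 1 -> z <> 0%C ->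
    Qf_is f z (1 + RtoC (2 * (1 - alpha)) * (z ^ n / (1 - z ^ n))
                 + RtoC (2 * INR n) * (z ^ n / (1 - (z ^ n) ^ 2)))%C.
Proof.
  intros Hn Hal.
  assert (Hn1 : 1 <= INR n) by (change 1 with (INR 1); apply le_INR; auto).
  set (beta := 2 * (1 - alpha) / INR n).
  assert (Hnb : INR n * beta = 2 * (1 - alpha)) by (unfold beta; field; lra).
  assert (Hb : 0 <= beta <= 2).
  { split; [apply Rle_div_r; lra | apply Rle_div_l; lra]. }
  set (b := fun k => RtoC (bcoef beta k)).
  (* h is (1 - w)^(-beta) and H is (1 - w)^(-beta-1). *)
  destruct (tame_function b (bcoef_tame beta Hb)) as [h Hh].
  destruct (tame_function _ (psum_bcoef_tame beta Hb)) as [H HH]. fold b in HH.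
  (* With exponent 0 the same construction gives the constant u = 1 and the geometric series G =
     1/(1 - w). *)
  set (e := fun k : nat => RtoC (bcoef 0 k)).
  destruct (tame_function e (bcoef_tame 0 ltac:(lra))) as [u Hu].
  destruct (tame_function _ (psum_bcoef_tame 0 ltac:(lra))) as [G HG]. fold e in HG.
  destruct (power_series_deriv b h Hh) as (h1 & Hh1 & Hha & _).
  assert (Hode : forall w, Cmod w < 1 -> ((1 - w) * h1 w = RtoC beta * h w)%C).
  { intros w Hw. apply binomial_ode; auto. }
  assert (Hnz : forall w, Cmod w < 1 -> h w <> 0%C).
  { apply (binomial_nonzero beta h h1); auto; [lra|].
    apply (Cseries_cv_at_0 b). apply Hh. rewrite Cmod_0; lra. }
  assert (Hu1 : forall w, Cmod w < 1 -> u w = 1%C).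
  { intros w Hw. apply (Cseries_cv_unique e w); auto. apply cser_cv.
    replace (RtoC 1) with (e 0%nat * w ^ 0 + 0 * u w)%C by (unfold e; simpl; ring).
    apply (cser_S (fun k => (e k * w ^ k)%C)).
    eapply cser_ext; [|exact (cser_scal 0 _ _ (proj1 (cser_cv _ _ _) (Hu w Hw)))].
    intros k. assert (E : bcoef 0 (S k) = 0); [|unfold e; rewrite E; ring].
    induction k as [|k IH]; [simpl; field|].
    change (bcoef 0 (S (S k))) with (bcoef 0 (S k) * (0 + INR (S k)) / INR (S (S k))).
    rewrite IH. unfold Rdiv; ring. }
  assert (HGw : forall w, Cmod w < 1 -> ((1 - w) * G w = 1)%C).
  { intros w Hw. rewrite (psum_series e w _ _ (Hu w Hw) (HG w Hw)). auto. }
  assert (HHw : forall w, Cmod w < 1 -> ((1 - w) * H w = h w)%C).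
  { intros w Hw. apply (psum_series b); auto. }
  assert (Hpow : forall z, Cmod z < 1 -> Cmod (z ^ n)%C < 1).
  { intros z Hz. rewrite Cmod_pow. apply pow_lt_1_compat; [split; [apply Cmod_ge_0 | auto] | lia]. }
  assert (HK : forall w c s, Cseries_cv c w s -> Cseries_cv (fun k => c k + shift c k)%C w ((1 + w) * s)%C).
  { intros w c s Hc. replace ((1 + w) * s)%C with (s + w * s)%C by ring.
    apply Cseries_cv_plus; auto. apply Cseries_cv_shift; auto. }
  set (g := fun z => (z * h (z ^ n))%C).
  set (p := fun z => ((1 + z ^ n) * G (z ^ n))%C).
  (* f is built from its own series through H, so that its expansion is available without
     multiplying the series of g and p. *)
  set (f := fun z => (z * ((1 + z ^ n) * H (z ^ n)))%C).
  assert (Hfgp : forall z, Cmod z < 1 -> f z = (g z * p z)%C).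
  { intros z Hz. specialize (Hpow z Hz). unfold f, g, p.
    rewrite <- (HHw _ Hpow).
    replace (z * ((1 - z ^ n) * H (z ^ n)) * ((1 + z ^ n) * G (z ^ n)))%C
      with (z * ((1 + z ^ n) * H (z ^ n)) * ((1 - z ^ n) * G (z ^ n)))%C by ring.
    rewrite (HGw _ Hpow). ring. }
  assert (Hpe : forall z, Cmod z < 1 -> p z = ((1 + z ^ n) / (1 - z ^ n))%C).
  { intros z Hz. specialize (Hpow z Hz). assert (N := one_minus_nonzero _ Hpow). unfold p.
    replace (G (z ^ n)%C) with ((1 - z ^ n) * G (z ^ n) / (1 - z ^ n))%C by (field; auto).
    rewrite (HGw _ Hpow). field. auto. }
  destruct (lacunary_A_n n b h g Hn eq_refl Hh (fun z => eq_refl)) as [HgA Hgcv].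
  destruct (lacunary_A_n n (fun k => psum b k + shift (psum b) k)%C
              (fun w => (1 + w) * H w)%C f Hn) as [HfA _].
  { simpl. unfold b. simpl. ring. }
  { intros w Hw. apply HK; auto. }
  { reflexivity. }
  assert (HpP : P_n n p).
  { split.
    - exists (lac n (fun k => psum e k + shift (psum e) k)%C). split; [|split].
      + unfold lac. rewrite Nat.Div0.mod_0_l, Nat.Div0.div_0_l. unfold e; simpl.
        change (RtoC 1 + RtoC 0 = RtoC 1)%C. ring.
      + intros k Hk1 Hk2. unfold lac. rewrite Nat.mod_small by lia. destruct k; [lia|]. reflexivity.
      + intros z Hz. apply Cseries_cv_lac; auto. apply HK. apply HG. apply Hpow, Hz.
    - intros z Hz. change (Cmod z < 1) in Hz. rewrite (Hpe z Hz). apply cayley_re_pos; auto. }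
  destruct (power_series_deriv _ g Hgcv) as (g1 & Hg1 & Hga & _).
  assert (Hga' : forall z, Cmod z < 1 -> ana g z (g1 z)) by exact Hga.
  (* In place of a chain rule, coefficients are compared: at degree m + 1 with m = n j, both sides
     have (1 + n j) b_j. *)
  assert (Hzg1 : forall z, Cmod z < 1 -> (z * g1 z = z * (h (z ^ n) + RtoC (INR n) * (z ^ n * h1 (z ^ n))))%C).
  { intros z Hz. specialize (Hpow z Hz).
    apply (Cseries_cv_unique _ _ _ _ (cser_euler _ _ _ (Hg1 z Hz))).
    assert (X := Cseries_cv_plus _ _ _ _ _ (Hh _ Hpow)
      (Cseries_cv_scal (RtoC (INR n)) _ _ _ (cser_euler _ _ _ (Hh1 _ Hpow)))).
    apply (Cseries_cv_lac n _ _ _ Hn), Cseries_cv_shift in X.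
    eapply Cseries_cv_ext; [|exact X].
    intros [|m]; simpl shift; [simpl; ring|]. unfold lac.
    destruct (Nat.eqb (m mod n) 0) eqn:E; [|ring].
    apply Nat.eqb_eq in E. assert (D := Nat.div_mod_eq m n). rewrite E, Nat.add_0_r in D.
    rewrite S_INR. replace (INR m) with (INR n * INR (m / n)) by (rewrite <- mult_INR, <- D; auto).
    rewrite RtoC_plus, RtoC_mult. ring. }
  assert (HgQ : forall z, Cmod z < 1 -> z <> 0%C ->
     Qf_is g z (1 + RtoC (2 * (1 - alpha)) * (z ^ n / (1 - z ^ n)))%C).
  { intros z Hz Hz0. specialize (Hpow z Hz). assert (N := one_minus_nonzero _ Hpow).
    apply (Qf_is_iff _ _ _ _ (Hga' z Hz)). specialize (Hnz _ Hpow). split.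
    - apply Cmult_neq_0; auto.
    - rewrite Hzg1 by auto. unfold g.
      replace (h1 (z ^ n)%C) with (RtoC beta * h (z ^ n) / (1 - z ^ n))%C.
      + rewrite <- Hnb, RtoC_mult. field. auto.
      + rewrite <- Hode by auto. field. auto. }
  exists f. split.
  - split; [exact HfA|]. exists g, p. split; [|split; [exact HpP|exact Hfgp]].
    split; [exact HgA|]. intros z Hz Hz0. change (Cmod z < 1) in Hz.
    eexists. split; [apply HgQ; auto|].
    specialize (Hpow z Hz). assert (N := one_minus_nonzero _ Hpow).
    assert (C := cayley_re_pos _ Hpow).
    (* In this form Re Q_g > alpha follows from the positive real part of (1 + w)/(1 - w). *)
    replace (1 + RtoC (2 * (1 - alpha)) * (z ^ n / (1 - z ^ n)))%C
      with (RtoC alpha + RtoC (1 - alpha) * ((1 + z ^ n) / (1 - z ^ n)))%C.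
    + change (alpha < fst (RtoC alpha + RtoC (1 - alpha) * ((1 + z ^ n) / (1 - z ^ n)))%C).
      set (q := ((1 + z ^ n) / (1 - z ^ n))%C) in *. destruct q; simpl in *. nra.
    + rewrite RtoC_mult, RtoC_minus. field. auto.
  - intros z Hz Hz0. specialize (Hpow z Hz). assert (N := one_minus_nonzero _ Hpow).
    assert (N2 : (1 + z ^ n)%C <> 0%C).
    { replace (1 + z ^ n)%C with (1 - (- z ^ n))%C by ring. apply one_minus_nonzero. rewrite Cmod_opp; auto. }
    set (A := ana_pow _ z _ n (ana_id z)).
    assert (Hpa := ana_div _ _ _ _ _ (ana_plus _ _ _ _ _ (ana_const 1%C z) A)
              (ana_minus _ _ _ _ _ (ana_const 1%C z) A) N).
    cbv beta in Hpa.
    assert (Hpa' : ana p z (RtoC (2 * INR n) * z ^ pred n / (1 - z ^ n) ^ 2)%C).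
    { apply (ana_local_ext (fun w => (1 + w ^ n) / (1 - w ^ n))%C) with (d0 := 1 - Cmod z); [lra| |].
      - intros k Hk. symmetry. apply Hpe. assert (T := Cmod_triangle z k). lra.
      - eapply ana_ext; [intros w; reflexivity| |exact Hpa]. rewrite RtoC_mult. field. auto. }
    assert (Hpz : p z <> 0%C).
    { rewrite Hpe by auto. intros E. apply N2.
      replace (1 + z ^ n)%C with ((1 + z ^ n) / (1 - z ^ n) * (1 - z ^ n))%C by (field; auto).
      rewrite E. ring. }
    assert (Q := Qf_product f g p z (g1 z) _ _ Hz Hfgp (Hga' z Hz) Hpa' Hpz (HgQ z Hz Hz0)).
    rewrite Hpe in Q by auto.
    match type of Q with Qf_is _ _ (_ + ?r)%C =>
      replace r with (RtoC (2 * INR n) * (z ^ n / (1 - (z ^ n) ^ 2)))%C in Q end; [exact Q|].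
    destruct n as [|m]; [lia|]. simpl pred.
    rewrite Cpow_S in *. field. repeat split; auto.
    replace (1 - (z * z ^ m) ^ 2)%C with ((1 - z * z ^ m) * (1 + z * z ^ m))%C by ring.
    apply Cmult_neq_0; auto.
Qed.

(** * Sharpness and the value of the radius *)

(** 5/3 - phi_Ne(u) = (u - 1)^2 (u + 2)/3, whose zeros 1 and -2 lie outside the open disc. *)
Lemma five_thirds_not_OmegaNe : ~ OmegaNe (RtoC (5 / 3)).
Proof.
  intros (u & Hu & E). change (Cmod u < 1) in Hu.
  change (RtoC (5 / 3) = ((1 + u) - u ^ 3 / RtoC 3)%C) in E.
  assert (H3 : RtoC 3 <> RtoC 0) by (intros X; apply RtoC_inj in X; lra).
  rewrite RtoC_div in E by lra.
  assert (F : ((u - 1) * ((u - 1) * (u + RtoC 2)) = 0)%C).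
  { replace ((u - 1) * ((u - 1) * (u + RtoC 2)))%C
      with (RtoC 3 * (RtoC 5 / RtoC 3 - ((1 + u) - u ^ 3 / RtoC 3)))%C.
    - rewrite E. ring.
    - field; auto. }
  revert F. repeat apply Cmult_neq_0; intros X.
  - apply Ceq_minus in X. rewrite X, Cmod_1 in Hu. lra.
  - apply Ceq_minus in X. rewrite X, Cmod_1 in Hu. lra.
  - assert (Y : u = RtoC (- (2))).
    { apply Ceq_minus. rewrite RtoC_opp. replace (u - - RtoC 2)%C with (u + RtoC 2)%C by ring. exact X. }
    rewrite Y, Cmod_R, Rabs_left in Hu; lra.
Qed.

Theorem mainTheorem10 (n : nat) (alpha : R) :
  (1 <= n)%nat -> 0 <= alpha < 1 ->
  is_radius_SNe (CSstar_n n alpha)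
    (Rpower
       (2 / (3 * (1 + INR n - alpha)
             + sqrt (9 * (1 + INR n - alpha) ^ 2 + 4 * (4 - 3 * alpha))))
       (1 / INR n)).
Proof.
  intros Hn Hal.
  assert (Hn1 : 1 <= INR n) by (change 1 with (INR 1); apply le_INR; auto).
  set (A := 1 + INR n - alpha). set (B := 4 - 3 * alpha).
  set (s := sqrt (9 * A ^ 2 + 4 * B)).
  assert (HA : 1 < A) by (unfold A; lra). assert (HB : 1 < B) by (unfold B; lra).
  assert (Hs2 : s * s = 9 * A ^ 2 + 4 * B) by (apply sqrt_sqrt; nra).
  assert (Hs0 : 0 <= s) by apply sqrt_pos.
  assert (Hs : 3 * A < s) by nra.
  (* The positive root (s - 3 A)/(2 B) of B x^2 + 3 A x = 1, with its numerator rationalised. *)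
  set (x := 2 / (3 * A + s)).
  assert (Hx0 : 0 < x) by (apply Rdiv_lt_0_compat; lra).
  assert (Hx1 : x < 1) by (apply Rlt_div_l; lra).
  assert (Hroot : B * x ^ 2 + 3 * A * x = 1).
  { assert (E : x * (3 * A + s) = 2) by (unfold x; field; lra).
    assert (E2 : s = 2 / x - 3 * A) by (apply Rmult_eq_reg_l with x; [|lra]; field_simplify; lra).
    rewrite E2 in Hs2. apply (f_equal (fun y => y * x ^ 2)) in Hs2.
    field_simplify in Hs2; [|lra]. nra. }
  set (rho := Rpower x (1 / INR n)).
  assert (Hrho0 : 0 < rho) by apply exp_pos.
  assert (Hrhon : rho ^ n = x).
  { rewrite <- Rpower_pow by auto. unfold rho. rewrite Rpower_mult.
    replace (1 / INR n * INR n) with 1 by (field; lra). apply Rpower_1; auto. }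
  assert (Hrho1 : rho < 1).
  { apply Rnot_le_lt; intros H. assert (P := pow_R1_Rle rho n H). lra. }
  split; [lra|]. split.
  - intros f Hf z Hz Hz0. change (Cmod z < rho) in Hz.
    apply (CSstar_maps_into_OmegaNe n alpha f z); auto; [lra|].
    fold A B.
    assert (Hzn : 0 <= Cmod z ^ n) by apply pow_le, Cmod_ge_0.
    assert (Cmod z ^ n < x).
    { rewrite <- Hrhon. apply Rnot_le_lt; intros H.
      assert (P := Cmod_ge_0 z).
      destruct n as [|m]; [lia|].
      assert (L : Cmod z ^ m <= rho ^ m) by (apply pow_incr; lra).
      assert (0 < rho ^ m) by (apply pow_lt; auto). simpl in H. nra. }
    assert (Q := Rmult_le_compat_l B _ _ ltac:(lra) (pow_incr (Cmod z ^ n) x 2 ltac:(lra))).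
    assert (3 * A * Cmod z ^ n < 3 * A * x) by (apply Rmult_lt_compat_l; lra). lra.
  (* If r > rho, the point rho lies in the open disc of radius r, where the extremal function takes
     the forbidden value 5/3. *)
  - intros r Hr Hall. apply Rnot_lt_le; intros Hlt.
    destruct (extremal_function n alpha Hn Hal) as (f & Hf & HQ).
    assert (Hm : Cmod (RtoC rho) = rho) by (rewrite Cmod_R, Rabs_pos_eq; lra).
    assert (Hz0 : RtoC rho <> RtoC 0) by (intros E; apply RtoC_inj in E; lra).
    destruct (Hall f Hf (RtoC rho)) as (q & Hq & HO).
    { change (Cmod (RtoC rho) < r). lra. }
    { exact Hz0. }
    specialize (HQ (RtoC rho) ltac:(lra) Hz0).
    destruct Hq as (_ & d & Hd & ->). destruct HQ as (_ & d' & Hd' & E').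
    rewrite (Cderiv_unique _ _ _ _ Hd Hd'), <- E' in HO.
    apply five_thirds_not_OmegaNe.
    rewrite <- RtoC_pow, Hrhon in HO.
    match type of HO with OmegaNe ?e => replace (RtoC (5 / 3)) with e; [exact HO|] end.
    rewrite <- RtoC_pow, <- !RtoC_minus, <- !RtoC_div, <- !RtoC_mult, <- !RtoC_plus by nra.
    f_equal. unfold A, B in Hroot.
    (* The excess of Q_f over 5/3 is a multiple of the quadratic that vanishes at x. *)
    assert (E : 1 + 2 * (1 - alpha) * (x / (1 - x)) + 2 * INR n * (x / (1 - x ^ 2)) - 5 / 3
       = 2 * ((4 - 3 * alpha) * x ^ 2 + 3 * (1 + INR n - alpha) * x - 1) / (3 * (1 - x ^ 2)))
      by (field; nra).
    rewrite Hroot in E. 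
    replace (2 * (1 - 1) / (3 * (1 - x ^ 2))) with 0 in E by (unfold Rdiv; ring). lra.
Qed.
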